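(* Let $n \geq 2$. There exists a meager subset $\mathcal{M}$ of $\mathcal{K}^n_r$ such that for every $C \in \mathcal{K}^n_r \setminus \mathcal{M}$, $$C = \overline{\Sigma(\partial C)}.$$
   Context: $\mathcal{K}^n_r$ is the space of all compact convex subsets $C$ of $\mathbf{R}^n$ with non-empty interior such that $\partial C$ is a $\mathcal{C}^1$-hypersurface, equipped with the Hausdorff metric. A subset of a metric space is meager if it is a countable union of nowhere-dense sets (here, relative to the space $\mathcal{K}^n_r$). A set $M \subseteq \mathbf{R}^n$ is a $\mathcal{C}^1$-hypersurface if for every $a \in M$ there exist an open set $U \subseteq \mathbf{R}^n$ containing $a$, an $(n-1)$-dimensional linear subspace $Z$ of $\mathbf{R}^n$, and a $\mathcal{C}^1$-diffeomorphism $\sigma : U \to \sigma(U)$ onto an open subset of $\mathbf{R}^n$ (i.e. $\sigma$ and $\sigma^{-1}$ are both of class $\mathcal{C}^1$) such that $\sigma(U \cap M) = Z \cap \sigma(U)$. For a non-empty closed set $K \subseteq \mathbf{R}^n$, $\delta_K(x) = \inf\{|x-a| : a \in K\}$ is the distance function from $K$, and its singular set is $\Sigma(K) = \{x \in \mathbf{R}^n \setminus K : \delta_K \text{ is not differentiable at } x\}$; $\overline{\Sigma(K)}$ is its closure in $\mathbf{R}^n$. *)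

(* Defs.v *)
From HB Require Import structures.
From mathcomp Require Import all_boot all_order all_algebra.
From mathcomp Require Import ring lra.
From mathcomp Require Import all_classical all_reals all_analysis.

Set Implicit Arguments.
Unset Strict Implicit.
Unset Printing Implicit Defensive.

Import Order.TTheory GRing.Theory Num.Theory.
Import numFieldNormedType.Exports.

Local Open Scope classical_set_scope.
Local Open Scope ring_scope.

(* The library's norm on ['rV[R]_n] is the sup norm.  It yields the same open
   sets and the same differentiable maps as the Euclidean norm, but not the
   same distances, so metric notions below go through [enorm]. *)
Definition enorm (R : realType) (n : nat) (x : 'rV[R]_n) : R :=
  Num.sqrt (\sum_(i < n) x ord0 i ^+ 2).

(* [inf] is a junk value when [K] is empty. *)
Definition dist_from (R : realType) (n : nat) (K : set 'rV[R]_n)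
    (x : 'rV[R]_n) : R :=
  inf [set enorm (x - a) | a in K].

Definition singular_set (R : realType) (n : nat) (K : set 'rV[R]_n) :
    set 'rV[R]_n :=
  [set x | ~ K x /\ ~ differentiable (dist_from K) x].

Definition boundary (T : topologicalType) (A : set T) : set T :=
  closure A `\` A°.

(* To be used with [U] open, so that only the values of [f] on [U] matter;
   continuity of the Jacobian matrix is continuity of the differential. *)
Definition C1_on (R : realType) (m n : nat) (U : set 'rV[R]_m)
    (f : 'rV[R]_m -> 'rV[R]_n) : Prop :=
  forall x, U x -> differentiable f x /\ {for x, continuous (jacobian f)}.

Definition C1_diffeo_on (R : realType) (n : nat) (U : set 'rV[R]_n)
    (sigma : 'rV[R]_n -> 'rV[R]_n) : Prop :=
  [/\ open (sigma @` U), C1_on U sigma &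
      exists2 tau : 'rV[R]_n -> 'rV[R]_n,
        (forall x, U x -> tau (sigma x) = x) & C1_on (sigma @` U) tau].

Definition C1_hypersurface (R : realType) (n : nat) (M : set 'rV[R]_n) : Prop :=
  forall a, M a ->
    exists (U : set 'rV[R]_n) (Z : {vspace 'rV[R]_n})
           (sigma : 'rV[R]_n -> 'rV[R]_n),
      [/\ open U /\ U a, (\dim Z = n.-1)%N, C1_diffeo_on U sigma &
          sigma @` (U `&` M) = [set` Z] `&` sigma @` U].

Record regular_body (R : realType) (n : nat) := RegularBody {
  body_set :> set 'rV[R]_n ;
  body_compact : compact body_set ;
  body_convex : convex_set body_set ;
  body_interior : body_set° !=set0 ;
  body_boundary : C1_hypersurface (boundary body_set) }.

Definition hausdorff_dist (R : realType) (n : nat) (A B : set 'rV[R]_n) : R :=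
  Num.max (sup [set dist_from B a | a in A]) (sup [set dist_from A b | b in B]).

Definition nowhere_dense (T : topologicalType) (A : set T) : Prop :=
  (closure A)° = set0.

Definition meager (T : topologicalType) (A : set T) : Prop :=
  exists2 F : (set T)^nat, (forall i, nowhere_dense (F i)) & A = \bigcup_i F i.

Section enorm_theory.
Context {R : realType} {n : nat}.
Implicit Types (x y : 'rV[R]_n) (A B C K : set 'rV[R]_n).

Lemma enorm_ge0 x : 0 <= enorm x.
Proof. exact: sqrtr_ge0. Qed.

Lemma sqr_enorm x : enorm x ^+ 2 = \sum_(i < n) x ord0 i ^+ 2.
Proof. by rewrite sqr_sqrtr// sumr_ge0// => i _; rewrite sqr_ge0. Qed.

Lemma enorm0 : enorm (0 : 'rV[R]_n) = 0.
Proof.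
by rewrite /enorm big1 ?sqrtr0// => i _; rewrite mxE expr0n.
Qed.

Lemma enormN x : enorm (- x) = enorm x.
Proof. by congr Num.sqrt; apply: eq_bigr => i _; rewrite mxE sqrrN. Qed.

Lemma enormB x y : enorm (x - y) = enorm (y - x).
Proof. by rewrite -enormN opprB. Qed.

Lemma coord_le_enorm x i : `|x ord0 i| <= enorm x.
Proof.
rewrite -sqrtr_sqr ler_sqrt ?sqr_ge0//; last first.
  by rewrite sumr_ge0// => j _; rewrite sqr_ge0.
by rewrite (bigD1 i)//= lerDl sumr_ge0// => j _; rewrite sqr_ge0.
Qed.

Lemma enorm_eq0 x : enorm x = 0 -> x = 0.
Proof.
move=> x0; apply/rowP => i; rewrite mxE; apply/eqP.
by rewrite -normr_le0 -x0 coord_le_enorm.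
Qed.

Lemma dot_le_enorm x y :
  \sum_(i < n) x ord0 i * y ord0 i <= enorm x * enorm y.
Proof.
have [/enorm_eq0->|x0] := eqVneq (enorm x) 0.
  by rewrite enorm0 mul0r big1// => i _; rewrite mxE mul0r.
have [/enorm_eq0->|y0] := eqVneq (enorm y) 0.
  by rewrite enorm0 mulr0 big1// => i _; rewrite mxE mulr0.
have xy0 : 0 < enorm x * enorm y.
  by rewrite mulr_gt0// lt_neqAle eq_sym enorm_ge0 ?x0 ?y0.
have : 0 <= \sum_(i < n) (enorm y * x ord0 i - enorm x * y ord0 i) ^+ 2.
  by rewrite sumr_ge0// => i _; rewrite sqr_ge0.
have -> : \sum_(i < n) (enorm y * x ord0 i - enorm x * y ord0 i) ^+ 2 =
    2 * (enorm x * enorm y) *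
      (enorm x * enorm y - \sum_(i < n) x ord0 i * y ord0 i).
  rewrite (eq_bigr (fun i => enorm y ^+ 2 * x ord0 i ^+ 2 +
     enorm x ^+ 2 * y ord0 i ^+ 2 -
     2 * (enorm x * enorm y) * (x ord0 i * y ord0 i))); last first.
    by move=> i _; ring.
  by rewrite big_split/= big_split/= sumrN -!mulr_sumr -!sqr_enorm; ring.
by rewrite pmulr_rge0 ?subr_ge0// mulr_gt0.
Qed.

Lemma enormD x y : enorm (x + y) <= enorm x + enorm y.
Proof.
rewrite -ler_sqr ?nnegrE ?addr_ge0 ?enorm_ge0//.
have -> : enorm (x + y) ^+ 2 = enorm x ^+ 2 + enorm y ^+ 2 +
    2 * \sum_(i < n) x ord0 i * y ord0 i.
  rewrite !sqr_enorm mulr_sumr -!big_split/=.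
  by apply: eq_bigr => i _; rewrite mxE; ring.
have := dot_le_enorm x y; rewrite sqrrD; lra.
Qed.

Lemma enorm_triangle y x z : enorm (x - z) <= enorm (x - y) + enorm (y - z).
Proof. by rewrite (le_trans _ (enormD _ _))// addrA subrK. Qed.

Lemma coord_le_norm x i : `|x ord0 i| <= `|x|.
Proof.
by rewrite [leRHS]/Num.norm/= mx_normrE; apply/bigmax_geP; right; exists (ord0, i).
Qed.

Lemma enorm_le_norm x : enorm x <= n%:R * `|x|.
Proof.
rewrite -ler_sqr ?nnegrE ?mulr_ge0 ?enorm_ge0// sqr_enorm exprMn.
apply: (@le_trans _ _ (\sum_(i < n) `|x| ^+ 2)).
  by apply: ler_sum => i _; rewrite -real_normK ?num_real// ler_sqr ?nnegrE//
    coord_le_norm.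
rewrite sumr_const card_ord -[leLHS]mulr_natl ler_wpM2r ?sqr_ge0//.
by rewrite -natrX ler_nat; case: (n) => // m; rewrite leq_pmulr.
Qed.

Lemma norm_le_enorm x : `|x| <= enorm x.
Proof.
rewrite [leLHS]/Num.norm/= mx_normrE; apply/bigmax_leP.
by split=> [|[i j] _ /=]; rewrite ?enorm_ge0// (ord1 i) coord_le_enorm.
Qed.

End enorm_theory.

Section dist_from_theory.
Context {R : realType} {n : nat}.
Implicit Types (x y : 'rV[R]_n) (A B C K : set 'rV[R]_n).

Lemma dist_from_le K x a : K a -> dist_from K x <= enorm (x - a).
Proof.
move=> Ka; apply: ge_inf; last by exists a.
by exists 0 => _ [b _ <-]; exact: enorm_ge0.
Qed.

Lemma le_dist_from K x r : K !=set0 ->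
  (forall a, K a -> r <= enorm (x - a)) -> r <= dist_from K x.
Proof.
move=> [a Ka] h; apply: lb_le_inf => [|_ [b Kb <-]]; last exact: h.
by exists (enorm (x - a)), a.
Qed.

Lemma dist_from_ge0 K x : K !=set0 -> 0 <= dist_from K x.
Proof. by move=> K0; apply: le_dist_from => // a _; exact: enorm_ge0. Qed.

Lemma dist_from_mem K x : K x -> dist_from K x = 0.
Proof.
move=> Kx; apply/eqP; rewrite eq_le dist_from_ge0 ?andbT; last by exists x.
by rewrite (le_trans (dist_from_le _ Kx))// subrr enorm0.
Qed.

Lemma dist_from_triangle K x y : K !=set0 ->
  dist_from K x <= enorm (x - y) + dist_from K y.
Proof.
move=> K0; rewrite -lerBlDl; apply: le_dist_from => // a Ka.
by rewrite lerBlDl (le_trans (dist_from_le _ Ka))// enorm_triangle.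
Qed.

Lemma dist_from_closure K x : K !=set0 -> dist_from K x <= 0 -> closure K x.
Proof.
move=> K0 dx U /nbhs_ballP[e /= e0 eU].
have : dist_from K x < e by exact: le_lt_trans e0.
move=> /inf_lt[|_ [a Ka <-] xae].
  by case: K0 => a Ka; exists (enorm (x - a)), a.
exists a; split=> //; apply: eU; rewrite -ball_normE/=.
exact: le_lt_trans (norm_le_enorm _) xae.
Qed.

Lemma dist_from_bounded A B : compact A -> B !=set0 ->
  has_ubound [set dist_from B a | a in A].
Proof.
move=> /compact_bounded[M [_ MA]] [b Bb].
exists (n%:R * (M + 1 + `|b|)) => _ [a Aa <-].
rewrite (le_trans (dist_from_le _ Bb))// (le_trans (enorm_le_norm _))//.
rewrite ler_wpM2l// (le_trans (ler_normB _ _))// lerD2r.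
by apply: (MA (M + 1)) => //; rewrite ltrDl.
Qed.

Lemma dist_from_le_hausdorff A B a : compact A -> B !=set0 -> A a ->
  dist_from B a <= hausdorff_dist A B.
Proof.
move=> cA B0 Aa; rewrite le_max; apply/orP; left.
by apply: ub_le_sup; [exact: dist_from_bounded|exists a].
Qed.

Lemma hausdorff_dist_le A B r : A !=set0 -> B !=set0 ->
  (forall a, A a -> dist_from B a <= r) ->
  (forall b, B b -> dist_from A b <= r) -> hausdorff_dist A B <= r.
Proof.
move=> [a Aa] [b Bb] Ar Br; rewrite ge_max; apply/andP; split.
  by apply: ge_sup => [|_ [c Ac <-]]; [exists (dist_from B a), a|exact: Ar].
by apply: ge_sup => [|_ [c Bc <-]]; [exists (dist_from A b), b|exact: Br].
Qed.

Lemma hausdorff_distC A B : hausdorff_dist A B = hausdorff_dist B A.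
Proof. exact: maxC. Qed.

Lemma hausdorff_distxx A : A !=set0 -> compact A -> hausdorff_dist A A = 0.
Proof.
move=> A0 cA; apply/eqP; rewrite eq_le; apply/andP; split.
  by apply: hausdorff_dist_le => // a Aa; rewrite dist_from_mem.
case: (A0) => a Aa.
by rewrite (le_trans _ (dist_from_le_hausdorff cA A0 Aa))// dist_from_ge0.
Qed.

Lemma hausdorff_dist_triangle B A C : A !=set0 -> B !=set0 -> C !=set0 ->
  compact A -> compact B -> compact C ->
  hausdorff_dist A C <= hausdorff_dist A B + hausdorff_dist B C.
Proof.
move=> A0 B0 C0 cA cB cC.
have half A' C' a : A' !=set0 -> C' !=set0 -> compact A' -> A' a ->
    dist_from C' a <= hausdorff_dist A' B + hausdorff_dist B C'.
  move=> A'0 C'0 cA' A'a.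
  rewrite -lerBlDr (le_trans _ (dist_from_le_hausdorff cA' B0 A'a))//.
  apply: le_dist_from => // b Bb; rewrite lerBlDr.
  by rewrite (le_trans (dist_from_triangle _ b C'0))// lerD2l
    dist_from_le_hausdorff.
apply: hausdorff_dist_le => // [a Aa|c Cc]; first exact: half.
by rewrite addrC (hausdorff_distC B) (hausdorff_distC A); exact: half.
Qed.

Lemma hausdorff_dist_eq0 A B : A !=set0 -> B !=set0 ->
  compact A -> compact B -> hausdorff_dist A B = 0 -> A = B.
Proof.
have half A' B' : A' !=set0 -> B' !=set0 -> compact A' -> compact B' ->
    hausdorff_dist A' B' = 0 -> A' `<=` B'.
  move=> A0 B0 cA cB AB0 a Aa.
  have /closure_id -> : closed B' by exact: compact_closed.
  by apply: dist_from_closure => //; rewrite -AB0 dist_from_le_hausdorff.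
move=> A0 B0 cA cB AB0; apply/seteqP; split; apply: half => //.
by rewrite hausdorff_distC.
Qed.

End dist_from_theory.

Section regular_body_metric.
Context {R : realType} {n : nat}.
Implicit Types A B C : regular_body R n.

Lemma body_nonempty A : A !=set0.
Proof. by have [x /interior_subset Ax] := body_interior A; exists x. Qed.

Lemma body_set_inj : injective (@body_set R n).
Proof.
move=> [A cA vA iA bA] [B cB vB iB bB] /= AB; subst B.
by congr RegularBody; exact: Prop_irrelevance.
Qed.

Let dist A B := hausdorff_dist A B.

Let distxx A : dist A A = 0.
Proof. exact: hausdorff_distxx (body_nonempty A) (@body_compact _ _ A). Qed.

Let dist_positivity A B : dist A B = 0 -> A = B.
Proof.
move=> AB; apply: body_set_inj.
by apply: hausdorff_dist_eq0 AB; try exact: body_nonempty; exact: body_compact.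
Qed.

Let distC A B : dist A B = dist B A. Proof. exact: hausdorff_distC. Qed.

Let dist_triangle B A C : dist A C <= dist A B + dist B C.
Proof.
by apply: hausdorff_dist_triangle;
  try exact: body_nonempty; exact: body_compact.
Qed.

HB.instance Definition _ := gen_eqMixin (regular_body R n).
HB.instance Definition _ := gen_choiceMixin (regular_body R n).
HB.instance Definition _ := isMetric.Build R (regular_body R n)
  distxx dist_positivity distC dist_triangle.

Lemma regular_body_mdistE A B : mdist A B = hausdorff_dist A B.
Proof. by []. Qed.

End regular_body_metric.

(* Main.v *)
From HB Require Import structures.
Require Import Defs.
From mathcomp Require Import all_boot all_order all_algebra.
From mathcomp Require Import ring lra.
From mathcomp Require Import all_classical all_reals all_analysis.

Set Implicit Arguments.
Unset Strict Implicit.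
Unset Printing Implicit Defensive.

Import Order.TTheory GRing.Theory Num.Theory.
Import numFieldNormedType.Exports.

Local Open Scope classical_set_scope.
Local Open Scope ring_scope.

(** The distance [delta] to the boundary of a convex body [C] is differentiable
    outside [C], where it is the distance to [C]; hence the closure of the
    singular set always lies in [C] ([singular_boundary_sub]). What has to be
    shown is that for most [C] the singular set is dense in [C].

    For a rational point [z] and a radius [r = 1/(k+1)], consider the bodies
    that contain [z] and have no singular point at distance less than [r] from
    [z]. The meager set is the union of these countably many families, and the
    work is to prove that each of them is nowhere dense
    ([singularity_free_nowhere_dense]). This rests on three facts.

    Stability ([two_nearest_points_stable]): if a point [x] of a convex body [P]
    has two distinct nearest boundary points [a] and [b], at distance [s], then
    every convex body close enough to [P] has a singular point in the ball of
    radius [r < s] around [x]. Indeed, wherever [delta] is differentiable its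
    gradient has norm one. If it were differentiable on the whole ball, it
    would thus grow at unit speed from [x] to some point of the sphere of radius
    [r] ([dist_ascent]), so that some point at distance [r] from [x] would be at
    distance about [s + r] from both [a] and [b]. Only the point opposite to [a]
    is that far from [a], and it is not opposite to [b] ([two_points_gap]).

    Creation ([two_nearest_points_cut]): every interior point [x] of a convex
    body [C] has two nearest boundary points in some convex body [P] as close to
    [C] as desired: near the contact point of the largest ball centred at [x],
    cut off a thin cap by another half-space tangent to this ball. This needs a
    second direction, that is, dimension at least two.

    Smoothing ([regular_bodies_dense]): the body [P] need not have a C1
    boundary, but bodies with a C1 boundary are dense among convex bodies. The
    function [phi x], the least value of [|x - x0 - l (p - x0)|^2 + e^2 l^2] for
    [l >= 0] and [p] in [P], is convex, and below a parabola touching it at any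
    given point, hence C1 ([convex_quadratic_C1]). It is homogeneous of degree two
    around [x0], so its sublevel set at [e^2], which lies between [P] and the
    [e]-neighbourhood of [P], has the C1 gauge [sqrt phi / e]; the boundary is
    the unit sphere of this gauge and has explicit charts
    ([gauge_hypersurface]). *)

(** * Euclidean norm, balls and convex sets *)

Section euclidean.
Context {R : realType} {n : nat}.
Implicit Types (x y z v : 'rV[R]_n) (A C K : set 'rV[R]_n) (k t r : R).

Definition dot x y : R := \sum_(i < n) x ord0 i * y ord0 i.

Lemma dotC x y : dot x y = dot y x.
Proof. by apply: eq_bigr => i _; rewrite mulrC. Qed.

Lemma dotDl x y z : dot (x + y) z = dot x z + dot y z.
Proof.
by rewrite /dot -big_split/=; apply: eq_bigr => i _; rewrite mxE mulrDl.
Qed.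

Lemma dotZl k x y : dot (k *: x) y = k * dot x y.
Proof. by rewrite /dot mulr_sumr; apply: eq_bigr => i _; rewrite mxE mulrA. Qed.

Lemma dotNl x y : dot (- x) y = - dot x y.
Proof. by rewrite -scaleN1r dotZl mulN1r. Qed.

Lemma dotBl x y z : dot (x - y) z = dot x z - dot y z.
Proof. by rewrite dotDl dotNl. Qed.

Lemma dotDr x y z : dot z (x + y) = dot z x + dot z y.
Proof. by rewrite !(dotC z) dotDl. Qed.

Lemma dotZr k x y : dot x (k *: y) = k * dot x y.
Proof. by rewrite !(dotC x) dotZl. Qed.

Lemma dotNr x y : dot x (- y) = - dot x y.
Proof. by rewrite !(dotC x) dotNl. Qed.

Lemma dotBr x y z : dot z (x - y) = dot z x - dot z y.
Proof. by rewrite !(dotC z) dotBl. Qed.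

Definition dotE := (dotDl, dotDr, dotNl, dotNr, dotZl, dotZr).

Lemma dotxx x : dot x x = enorm x ^+ 2.
Proof. by rewrite sqr_enorm; apply: eq_bigr => i _; rewrite expr2. Qed.

Lemma dot_le x y : dot x y <= enorm x * enorm y.
Proof. exact: dot_le_enorm. Qed.

Lemma sqr_enormD x y :
  enorm (x + y) ^+ 2 = enorm x ^+ 2 + 2 * dot x y + enorm y ^+ 2.
Proof. by rewrite -!dotxx !dotE (dotC y x); ring. Qed.

Lemma sqr_enormB x y :
  enorm (x - y) ^+ 2 = enorm x ^+ 2 - 2 * dot x y + enorm y ^+ 2.
Proof. by rewrite -!dotxx !dotE (dotC y x); ring. Qed.

Lemma enormZ k x : enorm (k *: x) = `|k| * enorm x.
Proof.
apply/eqP; rewrite -(@eqrXn2 _ 2)// ?mulr_ge0 ?enorm_ge0//.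
by rewrite -dotxx !dotE exprMn real_normK ?num_real// -dotxx mulrA expr2.
Qed.

Lemma enorm_gt0 x : (0 < enorm x) = (x != 0).
Proof.
rewrite lt_neqAle enorm_ge0 andbT eq_sym; congr (~~ _).
by apply/eqP/eqP => [/enorm_eq0//|->]; exact: enorm0.
Qed.

(** The ambient topology is that of the sup norm, and [enorm] is at most [n]
    times the sup norm. *)
Lemma enorm_lipschitz_continuous (f : 'rV[R]_n -> R) k :
  (forall x y, f x - f y <= k * enorm (x - y)) -> continuous f.
Proof.
move=> fk x; apply/(@cvgrPdist_lt _ _ _ (nbhs x) (nbhs_filter x)) => e e0.
have k0 : 0 < `|k| * n%:R + 1.
  by rewrite ltr_wpDl// mulr_ge0.
have : nbhs x (ball x (e / (`|k| * n%:R + 1))).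
  by apply/nbhs_ballP; exists (e / (`|k| * n%:R + 1)); rewrite //= divr_gt0.
apply: filterS => y; rewrite -ball_normE/= => xy.
have kxy : k * enorm (x - y) < e.
  apply: (@le_lt_trans _ _ ((`|k| * n%:R + 1) * `|x - y|)); last first.
    by rewrite mulrC -ltr_pdivlMr.
  rewrite (le_trans (ler_norm _))// normrM (ger0_norm (enorm_ge0 _)).
  rewrite mulrDl mul1r -mulrA.
  have : `|k| * enorm (x - y) <= `|k| * (n%:R * `|x - y|).
    by rewrite ler_wpM2l// enorm_le_norm.
  by have := normr_ge0 (x - y); lra.
rewrite ltr_norml; have := fk x y; have := fk y x.
by rewrite (enormB y x); lra.
Qed.

Lemma enorm_continuous : continuous (@enorm R n).
Proof.
apply: (@enorm_lipschitz_continuous _ 1) => x y.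
by rewrite mul1r lerBlDr -{1}(subrK y x) enormD.
Qed.

Lemma enormB_continuous x : continuous (fun y => enorm (y - x)).
Proof.
apply: (@enorm_lipschitz_continuous _ 1) => y z.
rewrite mul1r lerBlDr (le_trans _ (enormD _ _))//.
by rewrite addrA subrK.
Qed.

Lemma dist_from_continuous K : K !=set0 -> continuous (dist_from K).
Proof.
move=> K0; apply: (@enorm_lipschitz_continuous _ 1) => x y.
by rewrite mul1r lerBlDr dist_from_triangle.
Qed.

Lemma nbhs_enormP x A :
  nbhs x A <-> exists2 e : R, 0 < e & forall y, enorm (y - x) < e -> A y.
Proof.
split=> [/nbhs_ballP[e /= e0 eA]|[e e0 eA]].
  exists e => // y yx; apply: eA; rewrite -ball_normE/= distrC.
  exact: le_lt_trans (norm_le_enorm _) yx.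
have cx : {for x, continuous (fun y => enorm (y - x))}.
  exact: enormB_continuous.
have /(@cvgrPdist_lt _ _ _ (nbhs x) (nbhs_filter x))/(_ _ e0) := cx.
apply: filterS => y; rewrite subrr enorm0 sub0r normrN.
by rewrite (ger0_norm (enorm_ge0 _)) => /eA.
Qed.

Definition cball x r : set 'rV[R]_n := [set y | enorm (y - x) <= r].

Lemma cball_center x r : 0 <= r -> cball x r x.
Proof. by move=> r0; rewrite /cball/= subrr enorm0. Qed.

Lemma compact_enorm_bounded K : compact K ->
  exists2 D : R, 0 < D & forall x, K x -> enorm x <= D.
Proof.
move=> /compact_bounded[M [_ KM]]; exists (n%:R * (`|M| + 1) + 1).
  by rewrite ltr_wpDl// mulr_ge0// addr_ge0.
move=> x Kx; rewrite (le_trans (enorm_le_norm _))//.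
have : n%:R * `|x| <= n%:R * (`|M| + 1).
  rewrite ler_wpM2l//; apply: KM Kx.
  by rewrite ltr_pwDr// ler_norm.
by move/le_trans; apply; rewrite lerDl.
Qed.

Lemma enorm_bounded_compact K D :
  closed K -> (forall x, K x -> enorm x <= D) -> compact K.
Proof.
move=> cK KD; apply: bounded_closed_compact => //.
exists D; split; first exact: num_real.
move=> M DM x Kx; rewrite /= (le_trans (norm_le_enorm _))//.
by rewrite (le_trans (KD _ Kx))// ltW.
Qed.

Lemma closed_sublevel (f : 'rV[R]_n -> R) r :
  continuous f -> closed [set x | f x <= r].
Proof.
move=> cf; apply: (@closed_comp _ _ f [set s | s <= r]);
  by [move=> *; exact: cf|exact: closed_le].
Qed.

Lemma cball_compact x r : compact (cball x r).
Proof.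
apply: (@enorm_bounded_compact _ (enorm x + r)).
  apply: (@closed_sublevel (fun y => enorm (y - x))).
  exact: enormB_continuous.
move=> y yx; rewrite -(subrK x y) addrC.
by rewrite (le_trans (enormD _ _))// lerD2l.
Qed.

Lemma nearest_point K x : compact K -> K !=set0 ->
  exists2 p, K p & dist_from K x = enorm (x - p).
Proof.
move=> cK K0.
have cf : {within K, continuous (fun y => enorm (x - y))}.
  apply: continuous_subspaceT; apply: (@enorm_lipschitz_continuous _ 1) => y z.
  by rewrite mul1r lerBlDl (enormB y z) enorm_triangle.
have [p /set_mem Kp pmin] := EVT_min_rV K0 cK cf.
exists p => //; apply/eqP; rewrite eq_le dist_from_le//=.
by apply: le_dist_from => // a Ka; apply: pmin; exact: mem_set.
Qed.

Lemma convex_setP C : convex_set C <->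
  forall x y t, C x -> C y -> 0 <= t -> t <= 1 -> C (t *: x + (1 - t) *: y).
Proof.
split=> [cC x y t Cx Cy t0 t1|cC].
  have t01 : Itv.spec (@Itv.num_sem R) (Itv.Real `[0%Z, 1%Z]) t.
    by apply/andP; split; [exact: num_real|rewrite in_itv/= t0 t1].
  have := cC x y (Itv.mk t01) (mem_set Cx) (mem_set Cy).
  by move=> /set_mem.
move=> x y l /set_mem Cx /set_mem Cy; apply/mem_set.
by apply: cC.
Qed.

(** The homothety of ratio [1 - t] centred at [c] sends the ball around [b] to a
    ball around [t c + (1 - t) b], which convexity keeps inside [C]. *)
Lemma convex_interior C b c r t : convex_set C ->
  0 < r -> (forall y, enorm (y - b) < r -> C y) -> C c -> 0 <= t -> t < 1 ->
  C° (t *: c + (1 - t) *: b).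
Proof.
move=> /convex_setP cC r0 rC Cc t0 t1; apply/nbhs_enormP.
have t'0 : 0 < 1 - t by rewrite subr_gt0.
exists ((1 - t) * r); first by rewrite mulr_gt0.
move=> y yr.
pose w := (1 - t)^-1 *: (y - (t *: c + (1 - t) *: b)).
have -> : y = t *: c + (1 - t) *: (b + w).
  rewrite scalerDr scalerA divff ?gt_eqF// scale1r addrA.
  by rewrite addrC subrK.
apply: cC => //; last exact: ltW.
apply: rC; rewrite addrC addKr enormZ ger0_norm ?invr_ge0 ?ltW//.
by rewrite mulrC ltr_pdivrMr// mulrC.
Qed.

Lemma convex_closure_interior C : convex_set C -> C° !=set0 ->
  C `<=` closure C°.
Proof.
move=> cC [b /nbhs_enormP[r r0 rC]] c Cc U /nbhs_enormP[e e0 eU].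
pose d := enorm (b - c); have d0 : 0 <= d by exact: enorm_ge0.
pose t := e / (e + d + 1).
have t0 : 0 < t by rewrite divr_gt0//; lra.
have t1 : t <= 1 by rewrite ler_pdivrMr; lra.
exists ((1 - t) *: c + (1 - (1 - t)) *: b); split.
  by apply: (@convex_interior _ _ _ r) => //; lra.
apply: eU.
have -> : (1 - t) *: c + (1 - (1 - t)) *: b - c = t *: (b - c).
  by apply/rowP => i; rewrite !mxE; ring.
rewrite enormZ gtr0_norm// -/d /t mulrAC ltr_pdivrMr; last lra.
by rewrite ltr_pM2l//; lra.
Qed.

End euclidean.

(** * Convex sets and their boundaries *)

Section convex_bodies.
Context {R : realType} {n : nat}.
Implicit Types (x y z v : 'rV[R]_n) (A C P K : set 'rV[R]_n) (k t r s : R).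

Lemma boundary_sub C : closed C -> boundary C `<=` C.
Proof. by move=> cC x [+ _]; rewrite -(closure_id C).1. Qed.

Lemma boundary_compact C : compact C -> compact (boundary C).
Proof.
move=> cC; have clC : closed C by exact: compact_closed.
apply: (subclosed_compact _ cC); last exact: boundary_sub.
apply: closedI; first exact: closed_closure.
by apply: open_closedC; exact: open_interior.
Qed.

(** The last point of [C] on the segment from [y] to [z] works. *)
Lemma segment_meets_boundary C y z : closed C -> C y -> ~ C z ->
  exists2 t, 0 <= t <= 1 & boundary C (y + t *: (z - y)).
Proof.
move=> cC Cy Cz; pose g t := y + t *: (z - y).
have cg : continuous g.
  move=> t; apply: cvgD; first exact: cvg_cst.
  exact: scalel_continuous.
pose T := `[0, 1]%classic `&` (g @^-1` C).
have T0 : T !=set0.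
  exists 0; split; first by rewrite /= in_itv/= lexx ler01.
  by rewrite /g/= scale0r addr0.
have cT : compact T.
  apply: (subclosed_compact _ (@segment_compact _ 0 1)); last by move=> t [].
  apply: closedI; first exact: itv_closed.
  by apply: closed_comp => // t _; exact: cg.
have [|t /set_mem[/=]] := @compact_EVT_max _ R id T T0 cT.
  by apply: continuous_subspaceT => t; exact: cvg_id.
rewrite in_itv/= => t01 Ct tmax; exists t => //; split.
  exact: subset_closure.
move=> /nbhs_enormP[e e0 eC]; case/andP: (t01) => t0.
rewrite le_eqVlt => /predU1P[t1|t1].
  by apply: Cz; move: Ct; rewrite /g t1 scale1r addrC subrK.
pose d := enorm (z - y); have d0 : 0 <= d by exact: enorm_ge0.
pose h := Num.min (1 - t) (e / (d + 1)).
have h0 : 0 < h by rewrite lt_min subr_gt0 t1 divr_gt0//; lra.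
have ht : h <= 1 - t by rewrite ge_min lexx.
have he : h * (d + 1) <= e.
  by rewrite -ler_pdivlMr; [rewrite ge_min lexx orbT|lra].
have : t + h <= t.
  apply/tmax/mem_set; split; first by rewrite /= in_itv/=; lra.
  apply: eC; rewrite /g scalerDl addrA [X in X - _]addrC addrK.
  rewrite enormZ gtr0_norm// -/d; apply: lt_le_trans he.
  by rewrite ltr_pM2l; lra.
lra.
Qed.

(** Together with [le_dist_boundary], this identifies the distance from a
    point of [C] to the boundary with the radius of the largest ball inside
    [C]. *)
Lemma dist_boundary_le C y z : closed C -> C y -> ~ C z ->
  dist_from (boundary C) y <= enorm (y - z).
Proof.
move=> cC Cy Cz; have [t /andP[t0 t1] bt] := segment_meets_boundary cC Cy Cz.
rewrite (le_trans (dist_from_le _ bt))// opprD addNKr enormN enormZ ger0_norm//.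
by rewrite -(enormB z y) ler_piMl// enorm_ge0.
Qed.

Lemma le_dist_boundary C x r : boundary C !=set0 ->
  (forall y, enorm (y - x) < r -> C y) -> r <= dist_from (boundary C) x.
Proof.
move=> bC rC; apply: le_dist_from => // a [_ Cia].
rewrite leNgt; apply/negP => ar; apply: Cia; apply/nbhs_enormP.
exists (r - enorm (x - a)); first by rewrite subr_gt0.
move=> y ya; apply: rC; rewrite (le_lt_trans (enorm_triangle a _ _))//.
by rewrite (enormB a x); lra.
Qed.

(** Moving from the nearest point [p] towards [c] cannot decrease the distance
    to [x], so the derivative of the squared distance along [c - p] at [p] has
    a sign. *)
Lemma nearest_point_dot_le0 C x p c : convex_set C -> C p ->
  dist_from C x = enorm (x - p) -> C c -> dot (x - p) (c - p) <= 0.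
Proof.
move=> /convex_setP cC Cp xp Cc; rewrite leNgt; apply/negP => pc.
set k := dot _ _ in pc; pose d := enorm (c - p) ^+ 2.
have d0 : 0 <= d by rewrite sqr_ge0.
pose t := k / (k + d + 1).
have t0 : 0 < t by rewrite divr_gt0//; lra.
have t1 : t <= 1 by rewrite ler_pdivrMr; lra.
have := dist_from_le x (cC _ _ _ Cc Cp (ltW t0) t1).
have -> : x - (t *: c + (1 - t) *: p) = (x - p) - t *: (c - p).
  by apply/rowP => i; rewrite !mxE; ring.
rewrite xp -(ler_sqr (enorm_ge0 _) (enorm_ge0 _)) (sqr_enormB (x - p)).
rewrite enormZ dotZr -/k exprMn real_normK ?num_real// -/d.
have : t * d < k by rewrite /t mulrAC ltr_pdivrMr ?ltr_pM2l; lra.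
rewrite -(ltr_pM2l t0); nra.
Qed.

(** The cancellation law for Minkowski sums of convex sets: if a point [z] at
    distance at most [s - e] from [x] were outside [C], moving it by [e] away
    from [C] would lead to a point of [P] at distance more than [e] from
    [C]. *)
Lemma cball_erosion P C x s e : compact C -> convex_set C -> C !=set0 ->
  0 <= e -> (forall y, P y -> dist_from C y <= e) -> cball x s `<=` P ->
  cball x (s - e) `<=` C.
Proof.
move=> cC vC C0 e0 PC sP z; rewrite /cball/= => zx; apply: contrapT => Cz.
have [p Cp zp] := nearest_point z cC C0.
have d0 : 0 < enorm (z - p).
  by rewrite enorm_gt0 subr_eq0; apply/eqP => zp'; apply: Cz; rewrite zp'.
set d := enorm _ in d0.
pose u := d^-1 *: (z - p).
have u1 : enorm u = 1 by rewrite enormZ gtr0_norm ?invr_gt0// mulVf ?gt_eqF.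
have uz : dot u (z - p) = d.
  by rewrite dotZl dotxx -/d expr2 mulKf ?gt_eqF.
have Pw : P (z + e *: u).
  apply: sP; rewrite /cball/= addrAC (le_trans (enormD _ _))// enormZ u1.
  by rewrite mulr1 ger0_norm//; lra.
have [c Cc wc] := nearest_point (z + e *: u) cC C0.
have ewc : enorm (z + e *: u - c) <= e by rewrite -wc PC.
have uc : dot u (c - p) <= 0.
  rewrite dotZl pmulr_rle0 ?invr_gt0//.
  exact: (nearest_point_dot_le0 vC Cp zp Cc).
have uw : dot u (z + e *: u - c) <= e.
  by rewrite (le_trans (dot_le _ _))// u1 mul1r.
have : dot u (z - p) + e = dot u (z + e *: u - c) + dot u (c - p).
  have uu : dot u u = 1 by rewrite dotxx u1 expr1n.
  by rewrite !(dotDr, dotNr) dotZr uu; ring.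
rewrite uz; lra.
Qed.

(** If some [c] of [C] were beyond the tangent plane at [a] of the inscribed
    ball, [a] would be interior to the convex hull of [c] and of the ball. *)
Lemma supporting_halfspace C x a c : convex_set C ->
  (forall y, enorm (y - x) < enorm (a - x) -> C y) -> boundary C a -> C c ->
  dot (a - x) (c - x) <= enorm (a - x) ^+ 2.
Proof.
move=> vC; set s := enorm (a - x) => sC [_ Cia] Cc.
rewrite leNgt; apply/negP; set k := dot _ _ => ks; apply: Cia.
pose d := enorm (c - x) ^+ 2; have d0 : 0 <= d by rewrite sqr_ge0.
pose t := (k - s ^+ 2) / (k - s ^+ 2 + d + 1).
have t0 : 0 < t by rewrite divr_gt0//; lra.
have t1 : t < 1 by rewrite ltr_pdivrMr; lra.
have td : t * d < k - s ^+ 2 by rewrite /t mulrAC ltr_pdivrMr ?ltr_pM2l; lra.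
pose b := x + (1 - t)^-1 *: ((a - x) - t *: (c - x)).
have t'0 : 1 - t != 0 by rewrite gt_eqF// subr_gt0.
have -> : a = t *: c + (1 - t) *: b.
  rewrite /b scalerDr scalerA divff// scale1r.
  by apply/rowP => i; rewrite !mxE; ring.
have bs : enorm (b - x) < s.
  rewrite /b addrC addKr enormZ ger0_norm ?invr_ge0 ?subr_ge0 ?(ltW t1)//.
  rewrite mulrC ltr_pdivrMr ?subr_gt0//.
  rewrite -ltr_sqr ?nnegrE ?mulr_ge0 ?enorm_ge0 ?subr_ge0 ?(ltW t1)//.
  rewrite (sqr_enormB (a - x)) enormZ dotZr -/k -/s exprMn.
  rewrite real_normK ?num_real//.
  rewrite -/d.
  have tds : t * (t * d) < t * (k - s ^+ 2) by rewrite ltr_pM2l.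
  have tk0 : 0 < t * (k - s ^+ 2) by rewrite mulr_gt0// subr_gt0.
  have st0 : 0 <= s ^+ 2 * t ^+ 2 by rewrite mulr_ge0// sqr_ge0.
  nra.
apply: (@convex_interior _ _ _ _ _ (s - enorm (b - x))) => //; last exact: ltW.
  by rewrite subr_gt0.
move=> y yb; apply: sC; rewrite (le_lt_trans (enorm_triangle b _ _))//; lra.
Qed.

End convex_bodies.

(** * Differentials of convex functions *)

Section differential_tools.
Context {R : realType} {V W : normedModType R}.

Lemma diff_unique_bound (f : V -> W) (df : {linear V -> W}) x :
  continuous df ->
  (forall e, 0 < e ->
    \forall h \near 0, `|f (h + x) - f x - df h| <= e * `|h|) ->
  differentiable f x /\ 'd f x = df :> (V -> W).
Proof.
move=> cdf fe.
have fo : f \o shift x = cst (f x) + df +o_ 0 id.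
  apply/eqaddoP => e e0; apply: filterS (fe e e0) => h.
  by rewrite /= opprD addrA.
have dE := diff_unique cdf fo; split => //.
by apply/diff_locallyP; rewrite dE.
Qed.

(** Continuity of the differential is expressed through the directional
    derivatives: in finite dimension this is equivalent, and it passes through
    sums, products and compositions one direction at a time. *)
Definition C1_in (U : set V) (f : V -> W) :=
  forall x, U x -> differentiable f x /\
    forall v, {for x, continuous ('D_v f)}.

End differential_tools.

Section diff_le.
Context {R : realType} {V : normedModType R}.

(** A bound on difference quotients along a single ray bounds the differential
    in that direction; applied to [v] and to [- v], it turns one-sided
    estimates of a distance function into information on its gradient. *)
Lemma diff_le_ray (f : V -> R) x v c r : 0 < r -> differentiable f x ->
  (forall t, 0 < t -> t < r -> f (x + t *: v) <= f x + t * c) -> 'd f x v <= c.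
Proof.
move=> r0 dfx fc; rewrite leNgt; apply/negP => cd.
have : (fun h : R => h^-1 *: ((f \o shift x) (h *: v) - f x)) @ 0^' -->
    'd f x v.
  by rewrite -deriveE//; exact: diff_derivable.
move=> /cvgrPdist_lt/(_ ('d f x v - c)).
rewrite subr_gt0 => /(_ cd)[d /= d0 dh].
pose t := Num.min r d / 2.
have rd0 : 0 < Num.min r d by rewrite lt_min r0.
have t0 : 0 < t by rewrite divr_gt0.
have tr : t < Num.min r d by rewrite ltr_pdivrMr//; lra.
have /andP[tr' td] : (t < r) && (t < d) by rewrite -lt_min.
have := dh t; rewrite /ball_/= sub0r normrN gtr0_norm// => /(_ td).
rewrite gt_eqF// => /(_ isT).
have : t^-1 * (f (t *: v + x) - f x) <= c.
  by rewrite mulrC ler_pdivrMr// lerBlDl [t *: v + x]addrC [c * t]mulrC fc.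
rewrite ltr_norml => le /andP[_]; rewrite ltrD2l ltrN2 ltNge.
by move=> /negP; apply.
Qed.

End diff_le.

Section dot_linear.
Context {R : realType} {n : nat} (g : 'rV[R]_n).

Let dot_is_linear : linear (dot g : 'rV[R]_n -> R).
Proof. by move=> k x y; rewrite dotDr dotZr. Qed.

HB.instance Definition _ :=
  GRing.isLinear.Build R 'rV[R]_n R _ (dot g) dot_is_linear.

Lemma dot_continuous : continuous (dot g).
Proof.
apply: (@enorm_lipschitz_continuous _ _ _ (enorm g)) => x y.
by rewrite -dotBr dot_le.
Qed.

End dot_linear.

Section convex_smooth.
Context {R : realType} {n : nat}.
Implicit Types (x y h v : 'rV[R]_n) (phi : 'rV[R]_n -> R) (k t : R).

Definition convex_fun phi := forall x y t, 0 <= t -> t <= 1 ->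
  phi (t *: x + (1 - t) *: y) <= t * phi x + (1 - t) * phi y.

Section one_point.
Variables (phi : 'rV[R]_n -> R) (x g : 'rV[R]_n) (k : R).
Hypotheses (k0 : 0 <= k) (phi_convex : convex_fun phi).
Hypothesis phi_le : forall h, phi (x + h) <= phi x + dot g h + k * enorm h ^+ 2.

(** Midpoint convexity between [x + h] and [x - h] turns the upper bound
    at [- h] into a lower bound at [h]. *)
Lemma convex_quadratic_ge h : phi x + dot g h - k * enorm h ^+ 2 <= phi (x + h).
Proof.
have := @phi_convex (x + h) (x - h) 2^-1.
have -> : 2^-1 *: (x + h) + (1 - 2^-1) *: (x - h) = x.
  by apply/rowP => i; rewrite !mxE; field.
move=> /(_ ltac:(lra) ltac:(lra)).
have := phi_le (- h); rewrite dotNr enormN; lra.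
Qed.

(** Applying [convex_quadratic_ge] to [t h] and letting [t] tend to [0]
    removes the quadratic error, because convexity bounds [phi (x + t h)] by
    the chord. *)
Lemma convex_subgradient h : phi x + dot g h <= phi (x + h).
Proof.
rewrite leNgt; apply/negP; set e := phi x + _ => eh.
pose q := k * enorm h ^+ 2; have q0 : 0 <= q by rewrite mulr_ge0// sqr_ge0.
pose d := e - phi (x + h); have d0 : 0 < d by rewrite subr_gt0.
pose t := d / (d + q + 1).
have t0 : 0 < t by rewrite divr_gt0//; lra.
have t1 : t <= 1 by rewrite ler_pdivrMr; lra.
have tq : t * q < d by rewrite /t mulrAC ltr_pdivrMr ?ltr_pM2l; lra.
have := @phi_convex (x + h) x t (ltW t0) t1.
have -> : t *: (x + h) + (1 - t) *: x = x + t *: h.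
  by apply/rowP => i; rewrite !mxE; ring.
have := convex_quadratic_ge (t *: h).
rewrite dotZr enormZ exprMn real_normK ?num_real//.
have := ltr_pM2l t0 (t * q) d; rewrite tq /d /e /q; nra.
Qed.

Lemma convex_quadratic_diff :
  differentiable phi x /\ 'd phi x = dot g :> ('rV[R]_n -> R).
Proof.
apply: diff_unique_bound; first exact: dot_continuous.
move=> e e0.
pose c : R := k * n%:R ^+ 2 + 1.
have c0 : 0 < c by rewrite ltr_wpDl// mulr_ge0// sqr_ge0.
have : nbhs (0 : 'rV[R]_n) (ball 0 (e / c)).
  by apply/nbhs_ballP; exists (e / c); rewrite //= divr_gt0.
apply: filterS => h; rewrite -ball_normE/= sub0r normrN => hc.
have := phi_le h; have := convex_quadratic_ge h; rewrite (addrC x) => h1 h2.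
apply: (@le_trans _ _ (k * enorm h ^+ 2)).
  by rewrite ler_norml; apply/andP; split; lra.
have hh : enorm h ^+ 2 <= n%:R ^+ 2 * `|h| ^+ 2.
  by rewrite -exprMn ler_sqr ?nnegrE ?enorm_ge0 ?mulr_ge0// enorm_le_norm.
apply: (@le_trans _ _ (c * `|h| * `|h|)).
  have := ler_wpM2l k0 hh; have := sqr_ge0 `|h|; rewrite /c; nra.
by rewrite ler_wpM2r// -ler_pdivlMl// mulrC ltW.
Qed.

End one_point.

(** The gradient map [g] is [2 k]-Lipschitz: at a common point, the supporting
    plane at [x] is below [phi], while the parabola at [y] is above. *)
Lemma convex_quadratic_C1 phi (g : 'rV[R]_n -> 'rV[R]_n) k : 0 < k ->
  convex_fun phi ->
  (forall x h, phi (x + h) <= phi x + dot (g x) h + k * enorm h ^+ 2) ->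
  C1_in setT phi.
Proof.
move=> k0 cphi phig.
have dphi x := convex_quadratic_diff (ltW k0) cphi (phig x).
have sub x h := @convex_subgradient phi x (g x) k (ltW k0) cphi (phig x) h.
have lip x y : enorm (g x - g y) <= 2 * k * enorm (x - y).
  rewrite -ler_sqr ?nnegrE ?mulr_ge0 ?enorm_ge0 ?(ltW k0)//.
  (* the displacement at which this comparison is sharpest *)
  pose w := (2 * k)^-1 *: (g x - g y).
  have := sub x (y - x + w); have := phig x (y - x); have := phig y w.
  have -> : x + (y - x + w) = y + w by rewrite addrA (addrC x) subrK.
  have -> : x + (y - x) = y by rewrite addrC subrK.
  rewrite dotDr (enormB y x) => h1 h2 h3.
  have : dot (g x - g y) w <= k * enorm (x - y) ^+ 2 + k * enorm w ^+ 2.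
    by rewrite dotBl; lra.
  rewrite /w dotZr dotxx enormZ exprMn real_normK ?num_real//.
  set D := enorm _ ^+ 2 => h4.
  have := ler_wpM2l (ltW (mulr_gt0 (ltr0n _ 4) k0)) h4.
  have -> : 4%:R * k * ((2 * k)^-1 * D) = 2 * D by field; rewrite gt_eqF.
  have -> : 4%:R * k * (k * enorm (x - y) ^+ 2 + k * ((2 * k)^-1 ^+ 2 * D)) =
    (2 * k * enorm (x - y)) ^+ 2 + D by field; rewrite gt_eqF.
  by lra.
move=> x _; split=> [|v]; first by have [] := dphi x.
have -> : 'D_v phi = fun y => dot (g y) v.
  by apply/funext => y; have [dy dE] := dphi y; rewrite deriveE// dE.
apply: (@enorm_lipschitz_continuous _ _ _ (2 * k * enorm v)) => y z.
rewrite -dotBl (le_trans (dot_le _ _))// mulrAC ler_wpM2r ?enorm_ge0//.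
Qed.

End convex_smooth.

(** * Calculus of C1 functions *)

Section C1_calculus.
Context {R : realType} {V : normedModType R}.
Implicit Types (U : set V) (f g : V -> R).

Lemma near_eq_differentiable (f g : V -> R) x :
  (\forall y \near x, f y = g y) -> differentiable g x -> differentiable f x.
Proof.
move=> fg dg.
have [] // := @diff_unique_bound R _ _ f ('d g x) x.
  exact: diff_continuous.
move=> e e0.
have /eqaddoP/(_ _ e0) := diff_locally dg.
have fg0 : \forall h \near (0 : V), f (h + x) = g (h + x).
  by move: fg; rewrite (near_shift 0) subr0.
move: fg0; apply: filterS2 => h; rewrite /= => -> /=.
rewrite opprD addrA; congr (`|g _ - _ - _| <= _).
by rewrite (nbhs_singleton fg).
Qed.

Lemma differentiable_sqrt (f : V -> R) x : 0 < f x ->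
  differentiable f x -> differentiable (fun y => Num.sqrt (f y)) x /\
  'd (fun y => Num.sqrt (f y)) x =
    (fun v => (2 * Num.sqrt (f x))^-1 * 'd f x v) :> (V -> R).
Proof.
move=> fx0 df.
have [dsq dsqE] := is_derive1_sqrt fx0.
have dsqrt : differentiable (@Num.sqrt R) (f x) by exact/derivable1_diffP.
split; first exact: (differentiable_comp df dsqrt).
apply: (eq_trans (diff_comp df dsqrt)); apply/funext => v.
by rewrite [LHS]/= (deriv1E dsq) derive1E dsqE; exact: mulrC.
Qed.

Lemma continuous_eq_on (W : topologicalType) (U : set V) (g h : V -> W) x :
  open U -> U x -> (forall y, U y -> g y = h y) ->
  {for x, continuous h} -> {for x, continuous g}.
Proof.
move=> oU Ux gh ch; have {}ch : h @ x --> g x by rewrite gh.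
apply: cvg_trans ch.
apply: near_eq_cvg; have : nbhs x U by exact: open_nbhs_nbhs.
by apply: filterS => y Uy; rewrite gh.
Qed.

(** The formula for the derivatives only has to hold near [x], hence on the
    open set [U]. *)
Lemma C1_in_intro U f (df : V -> V -> R) : open U ->
  (forall x, U x -> differentiable f x) ->
  (forall x v, U x -> 'D_v f x = df x v) ->
  (forall v x, U x -> {for x, continuous (df ^~ v)}) -> C1_in U f.
Proof.
move=> oU dif dE cdf x Ux; split=> [|v]; first exact: dif.
exact: (continuous_eq_on oU Ux (fun y Uy => dE y v Uy) (cdf v x Ux)).
Qed.

Lemma C1_in_continuous U f x : C1_in U f -> U x -> {for x, continuous f}.
Proof. by move=> fU /fU[/differentiable_continuous]. Qed.

Lemma C1_in_sub U U' f : U' `<=` U -> C1_in U f -> C1_in U' f.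
Proof. by move=> UU fU x /UU; exact: fU. Qed.

Lemma C1_in_derivable U f x v : C1_in U f -> U x -> derivable f x v.
Proof. by move=> fU /fU[df _]; exact: diff_derivable. Qed.

Lemma C1_in_cst U (c : R) : open U -> C1_in U (fun=> c).
Proof.
move=> oU; apply: (@C1_in_intro _ _ (fun _ _ => 0)) => //.
  by move=> x v _; rewrite derive_cst.
by move=> v x _; exact: cst_continuous.
Qed.

Lemma C1_in_linear U (L : {linear V -> R}) : open U -> continuous L ->
  C1_in U L.
Proof.
move=> oU cL; apply: (@C1_in_intro U L (fun _ => L) oU).
- by move=> x _; exact: linear_differentiable.
- by move=> x v _; rewrite (deriveE _ (linear_differentiable x cL)) diff_lin.
- by move=> v x _; exact: cst_continuous.
Qed.

Lemma C1_in_add U f g : open U -> C1_in U f -> C1_in U g ->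
  C1_in U (fun x => f x + g x).
Proof.
move=> oU Cf Cg.
apply: (@C1_in_intro U (f + g) (fun x v => 'D_v f x + 'D_v g x)) => //.
- move=> x Ux; have [df _] := Cf _ Ux; have [dg _] := Cg _ Ux.
  exact: differentiableD.
- move=> x v Ux.
  by rewrite (deriveD (C1_in_derivable Cf Ux) (C1_in_derivable Cg Ux)).
- move=> v x Ux; have [_ cf] := Cf _ Ux; have [_ cg] := Cg _ Ux.
  by apply: (@cvgD _ _ _ _ (nbhs_filter x)); [exact: cf|exact: cg].
Qed.

Lemma C1_in_mul U f g : open U -> C1_in U f -> C1_in U g ->
  C1_in U (fun x => f x * g x).
Proof.
move=> oU Cf Cg.
apply: (@C1_in_intro U (f * g)
  (fun x v => f x * 'D_v g x + g x * 'D_v f x)) => //.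
- move=> x Ux; have [df _] := Cf _ Ux; have [dg _] := Cg _ Ux.
  exact: differentiableM.
- move=> x v Ux.
  by rewrite (deriveM (C1_in_derivable Cf Ux) (C1_in_derivable Cg Ux)).
- move=> v x Ux; have [_ cf] := Cf _ Ux; have [_ cg] := Cg _ Ux.
  have cfx := C1_in_continuous Cf Ux; have cgx := C1_in_continuous Cg Ux.
  apply: (@cvgD _ _ _ _ (nbhs_filter x)).
    by apply: (@cvgM _ _ _ (nbhs_filter x)); [exact: cfx|exact: cg].
  by apply: (@cvgM _ _ _ (nbhs_filter x)); [exact: cgx|exact: cf].
Qed.

Lemma C1_in_inv U f : open U -> C1_in U f -> (forall x, U x -> f x != 0) ->
  C1_in U (fun x => (f x)^-1).
Proof.
move=> oU Cf f0.
apply: (@C1_in_intro _ _ (fun x v => - (f x)^-1 ^+ 2 * 'D_v f x)) => //.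
- move=> x Ux; have [df _] := Cf _ Ux.
  by apply: differentiableV => //; exact: f0.
- move=> x v Ux.
  by rewrite (deriveV (f0 _ Ux) (C1_in_derivable Cf Ux)) exprVn.
- move=> v x Ux; have [_ cf] := Cf _ Ux.
  have cfx := C1_in_continuous Cf Ux.
  apply: (@cvgM _ _ _ (nbhs_filter x)); last exact: cf.
  apply: (@cvgN _ _ _ _ (nbhs_filter x)).
  apply: (@cvgM _ _ _ (nbhs_filter x)); apply: (@cvgV _ _ _ (nbhs_filter x));
    by [exact: f0|exact: cfx].
Qed.

Lemma C1_in_sqrt U f : open U -> C1_in U f -> (forall x, U x -> 0 < f x) ->
  C1_in U (fun x => Num.sqrt (f x)).
Proof.
move=> oU Cf f0.
apply: (@C1_in_intro _ _ (fun x v => (2 * Num.sqrt (f x))^-1 * 'D_v f x)) => //.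
- move=> x Ux; have [df _] := Cf _ Ux.
  by have [] := differentiable_sqrt (f0 _ Ux) df.
- move=> x v Ux; have [df _] := Cf _ Ux.
  have [ds dsE] := differentiable_sqrt (f0 _ Ux) df.
  by rewrite (deriveE _ ds) dsE (deriveE _ df).
- move=> v x Ux; have [_ cf] := Cf _ Ux.
  have cfx := C1_in_continuous Cf Ux.
  apply: (@cvgM _ _ _ (nbhs_filter x)); last exact: cf.
  apply: (@cvgV _ _ _ (nbhs_filter x)).
    by rewrite mulf_neq0// gt_eqF// sqrtr_gt0 f0.
  apply: (@cvgMr _ _ _ (nbhs_filter x)).
  apply: (@continuous_comp _ _ _ f (@Num.sqrt R)); first exact: cfx.
  exact: sqrt_continuous.
Qed.

Lemma C1_in_affine U f (c : V) (L : {linear V -> V}) :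
  open U -> continuous L -> C1_in U f ->
  C1_in [set y | U (c + L y)] (fun y => f (c + L y)).
Proof.
move=> oU cL Cf; pose A y := c + L y.
have cA : continuous A.
  by move=> y; apply: (@cvgD _ _ _ _ (nbhs_filter y));
    [exact: cvg_cst|exact: cL].
have dA y : differentiable A y /\ 'd A y = L :> (V -> V).
  apply: diff_unique_bound => // e e0.
  apply: nearW => h.
  rewrite /A linearD opprD !addrA.
  have -> : c + L h + L y - c - L y - L h = 0.
    by rewrite -(addrA c) (addrC c) !addrK subrr.
  by rewrite normr0 mulr_ge0// ltW.
apply: (@C1_in_intro _ (f \o A) (fun y v => 'D_(L v) f (A y))) => //.
- by apply: open_comp => // y _; exact: cA.
- move=> y Uy; have [df _] := Cf _ Uy; have [dAy _] := dA y.
  exact: (differentiable_comp dAy df).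
- move=> y v Uy; have [df _] := Cf _ Uy; have [dAy dE] := dA y.
  rewrite (deriveE _ (differentiable_comp dAy df)) (diff_comp dAy df)/= dE.
  by rewrite deriveE.
- move=> v y Uy; have [_ cf] := Cf _ Uy.
  apply: (@continuous_comp _ _ _ A ('D_(L v) f)); first exact: cA.
  exact: cf.
Qed.

Lemma derive_linear_comp (W : normedModType R) (f : V -> W)
    (L : {linear W -> R}) x v :
  continuous L -> differentiable f x ->
  'D_v (fun y => L (f y)) x = L ('D_v f x).
Proof.
move=> cL df; have dL := linear_differentiable (f x) cL.
rewrite (deriveE _ (differentiable_comp df dL)) (diff_comp df dL)/= diff_lin//.
by rewrite deriveE.
Qed.

End C1_calculus.

(** * Two nearest boundary points force nearby singularities *)

Section stability.
Context {R : realType} {n : nat}.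
Implicit Types (x y z a b v : 'rV[R]_n) (C P K : set 'rV[R]_n) (c r s : R).

(** Along the segment from [y] to a nearest point [a] of [K] the distance
    decreases at unit speed, so the differential takes the opposite value on
    [y - a]. *)
Lemma dist_diff_ge K y : compact K -> K !=set0 -> ~ K y ->
  differentiable (dist_from K) y ->
  exists2 v, 0 < enorm v & enorm v <= 'd (dist_from K) y v.
Proof.
move=> cK K0 Ky dK; have [a Ka ya] := nearest_point y cK K0.
exists (y - a).
  by rewrite enorm_gt0 subr_eq0; apply/eqP => yE; apply: Ky; rewrite yE.
rewrite -lerN2 -(linearN ('d (dist_from K) y)) opprB.
apply: (@diff_le_ray _ _ (dist_from K) y _ _ 1) => // t t0 t1.
rewrite ya (le_trans (dist_from_le _ Ka))//.
have -> : y + t *: (a - y) - a = (1 - t) *: (y - a).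
  by apply/rowP => i; rewrite !mxE; ring.
by rewrite enormZ ger0_norm; lra.
Qed.

(** The function [delta - c |. - x|], where [delta] is the distance to [K],
    cannot reach its maximum over the ball at an interior point, because the
    gradient of [delta] has norm [1 > c] there. This replaces following the
    gradient flow of [delta]. *)
Lemma dist_ascent K x r c : compact K -> K !=set0 ->
  0 <= r -> 0 <= c -> c < 1 ->
  (forall y, cball x r y -> ~ K y /\ differentiable (dist_from K) y) ->
  exists2 y, enorm (y - x) = r &
    dist_from K x + c * r <= dist_from K y.
Proof.
move=> cK K0 r0 c0 c1 Kd.
pose h y := dist_from K y - c * enorm (y - x).
have ch : {within cball x r, continuous h}.
  apply: continuous_subspaceT => y; apply: (@cvgB _ _ _ _ (nbhs_filter y)).
    exact: (dist_from_continuous K0).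
  by apply: cvgMr; exact: enormB_continuous.
have [|y /set_mem yr ymax] := EVT_max_rV _ (@cball_compact _ _ x r) ch.
  by exists x; exact: cball_center.
have hx := ymax x (mem_set (cball_center x r0)).
rewrite /h subrr enorm0 mulr0 subr0 in hx.
have {hx} hx : dist_from K x + c * enorm (y - x) <= dist_from K y by lra.
move: (yr); rewrite /cball/= le_eqVlt => /predU1P[yr'|yr'].
  by exists y; rewrite // -yr'.
have [Ky dKy] := Kd _ yr.
have [v v0 vd] := dist_diff_ge cK K0 Ky dKy.
suff : 'd (dist_from K) y v <= c * enorm v.
  move=> /(le_trans vd); rewrite -subr_le0 -{1}(mul1r (enorm v)) -mulrBl.
  by rewrite pmulr_lle0// leNgt subr_gt0 c1.
apply: (@diff_le_ray _ _ _ _ _ _ ((r - enorm (y - x)) / enorm v)) => //.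
  by rewrite divr_gt0// subr_gt0.
move=> t t0; rewrite ltr_pdivlMr// => tv.
have yt : enorm (y + t *: v - x) <= enorm (y - x) + t * enorm v.
  by rewrite addrAC (le_trans (enormD _ _))// enormZ gtr0_norm.
have ytr : cball x r (y + t *: v) by rewrite /cball/=; lra.
have := ymax _ (mem_set ytr); rewrite /h.
have := ler_wpM2l c0 yt; lra.
Qed.

(** Among the vectors [w] of norm [r], those at distance close to [s + r] from
    [a] are close to the direction of [- a]; as [enorm (a + b)] is less than
    [2 s] when [a] and [b] differ, this cannot happen for both when [e] is
    small. *)
Lemma two_points_gap a b w r s e : enorm a = s -> enorm b = s -> enorm w = r ->
  0 <= s + r - e -> s + r - e <= enorm (w - a) -> s + r - e <= enorm (w - b) ->
  r * (2 * s - enorm (a + b)) <= 2 * (s + r) * e.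
Proof.
move=> sa sb wr e0 wa wb.
have := dot_le (- w) (a + b); rewrite enormN wr dotNl dotDr.
move: wa; rewrite -ler_sqr ?nnegrE ?enorm_ge0// sqr_enormB wr sa => wa.
move: wb; rewrite -ler_sqr ?nnegrE ?enorm_ge0// sqr_enormB wr sb => wb.
have := sqr_ge0 e; nra.
Qed.

Lemma enormD_lt a b s : enorm a = s -> enorm b = s -> a != b ->
  enorm (a + b) < 2 * s.
Proof.
move=> sa sb ab; have s0 : 0 <= s by rewrite -sa enorm_ge0.
rewrite -ltr_sqr ?nnegrE ?enorm_ge0 ?mulr_ge0//.
have := sqr_enormB a b; rewrite (sqr_enormD a b) sa sb.
have : 0 < enorm (a - b) ^+ 2 by rewrite exprn_gt0// enorm_gt0 subr_eq0.
nra.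
Qed.

(** A body [C] without singular point in the ball would have, by
    [dist_ascent], a point at distance [r] from [x] whose distance to the
    boundary of [C] is almost [s + r]; as the boundary of [C] passes near [a]
    and [b], this contradicts [two_points_gap]. *)
Lemma two_nearest_points_stable P x a b s r : compact P -> convex_set P ->
  0 < r -> r < s -> cball x s `<=` P -> boundary P a -> boundary P b ->
  enorm (a - x) = s -> enorm (b - x) = s -> a != b ->
  exists2 e, 0 < e & forall C, compact C -> convex_set C -> C !=set0 ->
    hausdorff_dist P C < e ->
    exists2 y, cball x r y & singular_set (boundary C) y.
Proof.
move=> cP vP r0 rs sP bPa bPb sa sb ab.
have := @enormD_lt (a - x) (b - x) s sa sb.
rewrite (inj_eq (addIr _)) => /(_ ab).
rewrite -subr_gt0; set g := _ - _ => g0.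
have gs : g <= 2 * s by rewrite /g gerBl enorm_ge0.
have sr0 : 0 < s + r by lra.
(* The ascent loses [k r] and the Hausdorff distance at most [3 e <= k r]; the
   factor 8 keeps the total loss [2 k r] below the gap [r g / (2 (s + r))]. *)
have [k k0 kE] : exists2 k, 0 < k & k * (s + r) = g / 8.
  by exists (g / 8 / (s + r)); rewrite ?divr_gt0// divfK ?gt_eqF.
have k1 : k < 1 by rewrite -(ltr_pM2r sr0) kE; lra.
pose e := Num.min ((s - r) / 3) (k * r / 3).
have e0 : 0 < e by rewrite lt_min !divr_gt0 ?mulr_gt0 ?subr_gt0.
have e1 : 3 * e <= s - r by rewrite mulrC -ler_pdivlMr// ge_min lexx.
have e2 : 3 * e <= k * r by rewrite mulrC -ler_pdivlMr// ge_min lexx orbT.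
have P0 : P !=set0 by exists x; apply: sP; apply: cball_center; lra.
exists e => // C cC vC C0 PCe; apply: contrapT => noS.
have clC : closed C by exact: compact_closed.
have PC y : P y -> dist_from C y <= e.
  by move=> Py; rewrite (le_trans (dist_from_le_hausdorff cP C0 Py))// ltW.
have CP y : C y -> dist_from P y <= e.
  move=> Cy; rewrite (le_trans (dist_from_le_hausdorff cC P0 Cy))//.
  by rewrite hausdorff_distC ltW.
have sC : cball x (s - e) `<=` C := cball_erosion cC vC C0 (ltW e0) PC sP.
(* Otherwise [cball_erosion] would put a ball around [z] inside [P]. *)
have outside z : boundary P z -> exists2 z', ~ C z' & enorm (z - z') <= 2 * e.
  move=> [_ Piz]; apply: contrapT => noz; apply: Piz.
  apply/nbhs_enormP; exists e => // y yz.
  apply: (@cball_erosion _ _ C P z (2 * e) e) => //; first exact: ltW.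
    move=> y'; rewrite /cball/= enormB => y'z; apply: contrapT => Cy'.
    by apply: noz; exists y'.
  by rewrite /cball/=; lra.
have [a' Ca' aa'] := outside _ bPa; have [b' Cb' bb'] := outside _ bPb.
have Cx : C x by apply: sC; apply: cball_center; lra.
have B0 : boundary C !=set0.
  by have [t _ bt] := segment_meets_boundary clC Cx Ca'; eexists; exact: bt.
have xs : s - e <= dist_from (boundary C) x.
  by apply: le_dist_boundary => // y /ltW; exact: sC.
have [|||y yx yd] := @dist_ascent (boundary C) x r (1 - k)
    (boundary_compact cC) B0 (ltW r0); [lra|lra| |].
  move=> y yr; have nby : ~ boundary C y.
    move=> [_]; apply; apply/nbhs_enormP; exists (s - e - r); first lra.
    move=> z zy; apply: sC; rewrite /cball/=.
    rewrite (le_trans (enorm_triangle y _ _))//.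
    by move: yr; rewrite /cball/=; lra.
  split => //; apply: contrapT => ndy; apply: noS.
  by exists y.
have Cy : C y by apply: sC; rewrite /cball/= yx; lra.
have far z z' : ~ C z' -> enorm (z - z') <= 2 * e ->
    s + r - (k * r + 3 * e) <= enorm ((y - x) - (z - x)).
  move=> Cz' zz'; have := dist_boundary_le clC Cy Cz'.
  have := enorm_triangle z y z'.
  have -> : y - x - (z - x) = y - z by rewrite opprB addrA subrK.
  by lra.
have := two_points_gap sa sb yx _ (far _ _ Ca' aa') (far _ _ Cb' bb').
rewrite -/g => /(_ ltac:(nra)).
have := mulr_gt0 r0 g0; have := ler_wpM2l (ltW sr0) e2.
have := ler_wpM2l (ltW r0) (lexx (k * (s + r))); rewrite {2}kE.
lra.
Qed.

End stability.

(** * Creating a second nearest boundary point *)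

Section cut.
Context {R : realType} {n : nat}.
Implicit Types (x y z a b c v : 'rV[R]_n) (C P K : set 'rV[R]_n) (r s : R).

Lemma dot_delta v i : dot v (delta_mx ord0 i) = v ord0 i.
Proof.
rewrite /dot (bigD1 i)//= big1 ?addr0 => [|j ji]; rewrite mxE/= ?eqxx ?mulr1//.
by rewrite (negbTE ji) mulr0.
Qed.

Lemma ex_orthogonal a : (2 <= n)%N -> a != 0 -> exists2 v, v != 0 & dot a v = 0.
Proof.
move=> n2 /rV0Pn[i ai].
have [j ji] : exists j : 'I_n, j != i.
  have n0 : (0 < n)%N by exact: ltn_trans n2.
  have [i0|i0] := eqVneq (i : nat) 0%N.
    by exists (Ordinal n2); rewrite -val_eqE/= i0.
  by exists (Ordinal n0); rewrite -val_eqE/= eq_sym.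
exists (a ord0 j *: delta_mx ord0 i - a ord0 i *: delta_mx ord0 j).
  apply/rV0Pn; exists j; rewrite !mxE eqxx (negbTE ji)/= mulr0 sub0r mulr1.
  by rewrite oppr_eq0.
by rewrite dotBr !dotZr !dot_delta mulrC subrr.
Qed.

Lemma cball_sub_closed C x s : closed C -> 0 < s ->
  (forall y, enorm (y - x) < s -> C y) -> cball x s `<=` C.
Proof.
move=> cC s0 sC y; rewrite /cball/= => yx.
rewrite (closure_id C).1// => U /nbhs_enormP[e e0 eU].
pose t := e / (e + s); have t0 : 0 < t by rewrite divr_gt0//; lra.
have t1 : t < 1 by rewrite ltr_pdivrMr; lra.
have ts : t * s < e by rewrite /t mulrAC ltr_pdivrMr ?ltr_pM2l; lra.
exists (y + (- t) *: (y - x)); split.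
  apply: sC; have -> : y + (- t) *: (y - x) - x = (1 - t) *: (y - x).
    by apply/rowP => i; rewrite !mxE; ring.
  rewrite enormZ gtr0_norm ?subr_gt0//.
  have := enorm_ge0 (y - x); nra.
apply: eU; rewrite addrC addKr enormZ normrN gtr0_norm//.
by apply: le_lt_trans ts; rewrite ler_pM2l.
Qed.

Lemma ex_not_mem_compact C : (0 < n)%N -> compact C -> exists z, ~ C z.
Proof.
move=> n0 /compact_enorm_bounded[D D0 CD].
exists ((D + 1) *: delta_mx ord0 (Ordinal n0)) => /CD.
have := coord_le_enorm ((D + 1) *: delta_mx ord0 (Ordinal n0)) (Ordinal n0).
rewrite !mxE !eqxx mulr1 ger0_norm; lra.
Qed.

(** Cutting off a thin cap of [C] by a half-space tangent to the inscribed ball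
    centred at [x], close to the contact point [a] of this ball, creates a
    second contact point [b]. *)
Lemma two_nearest_points_cut C x e : (2 <= n)%N -> compact C -> convex_set C ->
  C° x -> 0 < e ->
  exists P, [/\ compact P, convex_set P, hausdorff_dist P C <= e &
    exists s a b, [/\ 0 < s, cball x s `<=` P, boundary P a /\ boundary P b,
      enorm (a - x) = s /\ enorm (b - x) = s & a != b]].
Proof.
move=> n2 cC vC Cix e0; have clC : closed C by exact: compact_closed.
have Cx : C x by exact: interior_subset.
have [z Cz] := ex_not_mem_compact (ltn_trans (isT : (0 < 1)%N) n2) cC.
have B0 : boundary C !=set0.
  by have [t _ bt] := segment_meets_boundary clC Cx Cz; eexists; exact: bt.
have [a Ba xa] := nearest_point x (boundary_compact cC) B0.
have ax0 : a - x != 0.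
  by rewrite subr_eq0; apply/eqP => ax; case: Ba => _; rewrite ax.
set A := a - x in ax0 *; pose s := enorm A.
have s0 : 0 < s by rewrite enorm_gt0.
have sC y : enorm (y - x) < s -> C y.
  move=> ys; apply: contrapT => /(dist_boundary_le clC Cx); rewrite xa.
  by rewrite (enormB x a) (enormB x y) leNgt => /negP; apply.
have scC := cball_sub_closed clC s0 sC.
have half c : C c -> dot A (c - x) <= s ^+ 2.
  by move=> Cc; exact: (supporting_halfspace vC sC Ba Cc).
have [E E0 AE] := ex_orthogonal n2 ax0.
have {}E0 : 0 < enorm E by rewrite enorm_gt0.
have [D0 D00 CD0] := compact_enorm_bounded cC; pose D := D0 + enorm x.
have D_gt0 : 0 < D by rewrite ltr_wpDr// enorm_ge0.
have CD c : C c -> enorm (c - x) <= D.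
  move=> Cc; rewrite (le_trans (enormD _ _))// enormN /D.
  by have := CD0 _ Cc; lra.
(* The tilt [t] makes [C] overshoot the new half-space by at most [t |E| D], so
   that shrinking [C] towards [x] by [s^2 / (s^2 + t |E| D)] puts it inside and
   moves its points by at most [t |E| D^2 / s^2 = e]. *)
pose t := e * s ^+ 2 / (enorm E * D ^+ 2).
have t0 : 0 < t by rewrite divr_gt0 ?mulr_gt0 ?exprn_gt0.
have tE : t * enorm E * D ^+ 2 = e * s ^+ 2.
  by rewrite /t -mulrA divfK// gt_eqF// mulr_gt0 ?exprn_gt0.
pose v := A + t *: E.
have vs : s <= enorm v.
  rewrite -ler_sqr ?nnegrE ?enorm_ge0// /v (sqr_enormD A) dotZr AE !mulr0 addr0.
  by rewrite lerDl sqr_ge0.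
have v0 : 0 < enorm v by exact: lt_le_trans vs.
pose P := C `&` [set y | dot v (y - x) <= s * enorm v].
pose b := x + (s / enorm v) *: v.
have bx : b - x = (s / enorm v) *: v by rewrite /b addrC addKr.
have bs : enorm (b - x) = s.
  by rewrite bx enormZ gtr0_norm ?divr_gt0// divfK// gt_eqF.
have sP : cball x s `<=` P.
  move=> y ys; split; first exact: scC.
  by rewrite /= (le_trans (dot_le _ _))// mulrC ler_pM2r.
have clP : closed P.
  apply: closedI => //; apply: (@closed_sublevel _ _ (fun y => dot v (y - x))).
  apply: (@enorm_lipschitz_continuous _ _ _ (enorm v)) => y y'.
  have -> : dot v (y - x) - dot v (y' - x) = dot v (y - y').
    by rewrite !dotBr; ring.
  exact: dot_le.
have cP : compact P by apply: (subclosed_compact clP cC) => y [].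
have P0 : P !=set0 by exists x; apply: sP; apply: cball_center; exact: ltW.
exists P; split => //.
- apply/convex_setP => y y' k [Cy Py] [Cy' Py'] k0 k1; split.
    by move/convex_setP : vC; exact.
  rewrite /=.
  have -> : k *: y + (1 - k) *: y' - x = k *: (y - x) + (1 - k) *: (y' - x).
    by apply/rowP => i; rewrite !mxE; ring.
  by rewrite dotDr !dotZr; move: Py Py'; rewrite /=; nra.
- apply: hausdorff_dist_le => //; first by exists x.
    by move=> y [Cy _]; rewrite dist_from_mem// ltW.
  move=> c Cc; pose q := t * enorm E * D.
  have q0 : 0 < q by do 2?apply: mulr_gt0.
  have s20 : 0 < s ^+ 2 by rewrite exprn_gt0.
  pose m := s ^+ 2 / (s ^+ 2 + q).
  have m0 : 0 < m by rewrite divr_gt0//; lra.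
  have m1 : m <= 1 by rewrite ler_pdivrMr; lra.
  have mq : m * (s ^+ 2 + q) = s ^+ 2 by rewrite /m divfK// gt_eqF//; lra.
  have Pm : P (m *: c + (1 - m) *: x).
    split; first by move/convex_setP : vC; apply => //; exact: ltW.
    rewrite /=.
    have -> : m *: c + (1 - m) *: x - x = m *: (c - x).
      by apply/rowP => i; rewrite !mxE; ring.
    rewrite dotZr /v dotDl dotZl.
    have : dot A (c - x) + t * dot E (c - x) <= s ^+ 2 + q.
      rewrite lerD ?half// /q -mulrA ler_pM2l// (le_trans (dot_le _ _))//.
      by rewrite ler_pM2l// CD.
    rewrite -(ler_pM2l m0) mq => /le_trans; apply.
    by rewrite expr2 ler_pM2l.
  rewrite (le_trans (dist_from_le _ Pm))//.
  have -> : c - (m *: c + (1 - m) *: x) = (1 - m) *: (c - x).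
    by apply/rowP => i; rewrite !mxE; ring.
  rewrite enormZ ger0_norm ?subr_ge0//.
  have := ler_wpM2l (_ : 0 <= 1 - m) (CD _ Cc); rewrite subr_ge0 => /(_ m1).
  move/le_trans; apply; rewrite -(ler_pM2r s20) -tE.
  have -> : (1 - m) * D * s ^+ 2 = m * q * D.
    by rewrite mulrAC mulrBl mul1r -[X in X - _]mq; ring.
  have -> : t * enorm E * D ^+ 2 = 1 * q * D by rewrite /q; ring.
  by rewrite !ler_pM2r.
- exists s, a, b; split => //; first split.
  + split; first by apply/subset_closure/sP; rewrite /cball/=.
    by move=> /(interiorS (@subIsetl _ _ _)) Cia; case: Ba.
  + split; first by apply/subset_closure/sP; rewrite /cball/= bs.
    move=> /nbhs_enormP[d d0 dP].
    have [|_] := dP (b + (d / 2 / enorm v) *: v).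
      rewrite addrC addKr enormZ gtr0_norm ?divr_gt0// divfK ?gt_eqF//; lra.
    rewrite /= addrAC dotDr bx !dotZr dotxx expr2 !mulrA !divfK ?gt_eqF//.
    have := mulr_gt0 d0 v0; lra.
  + apply/eqP => ab; have := bx; rewrite -ab -/A => /(congr1 (dot E)).
    rewrite dotZr /v (dotDr A) dotZr (dotC E A) AE add0r dotxx => /eqP.
    have := mulr_gt0 (divr_gt0 s0 v0) (mulr_gt0 t0 (exprn_gt0 2 E0)).
    by move=> /lt_eqF ->.
Qed.

End cut.

(** * Smoothing by quadratic envelopes *)

Section envelope.
Context {R : realType} {n : nat}.
Implicit Types (x y p v h : 'rV[R]_n) (C P : set 'rV[R]_n) (e k t : R).
Implicit Types (s : 'rV[R]_n * R) (S : set ('rV[R]_n * R)).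

Definition cost s x : R := enorm (x - s.1) ^+ 2 + s.2.

(** The lower envelope of the parabolas [cost s], that is, the infimal
    convolution of the squared norm and of the lower boundary of [S]; the
    infimum is required to be attained. *)
Definition is_envelope S (phi : 'rV[R]_n -> R) := forall x,
  (forall s, S s -> phi x <= cost s x) /\ (exists2 s, S s & phi x = cost s x).

(** The points of [R^n x R] above [S] form a convex set. *)
Definition mixable S := forall s s' t, S s -> S s' -> 0 <= t -> t <= 1 ->
  exists2 r, S (t *: s.1 + (1 - t) *: s'.1, r) & r <= t * s.2 + (1 - t) * s'.2.

Lemma cost_shift s x h :
  cost s (x + h) = cost s x + dot (2 *: (x - s.1)) h + 1 * enorm h ^+ 2.
Proof. by rewrite /cost (addrAC x) (sqr_enormD (x - s.1)) dotZl; ring. Qed.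

Lemma envelope_convex S phi : mixable S -> is_envelope S phi -> convex_fun phi.
Proof.
move=> mS eS x y t t0 t1.
have [_ [s Ss ->]] := eS x; have [_ [s' Ss' ->]] := eS y.
have [r Sr rle] := mS _ _ _ Ss Ss' t0 t1.
rewrite (le_trans ((eS _).1 _ Sr))// /cost/=.
have -> : t *: x + (1 - t) *: y - (t *: s.1 + (1 - t) *: s'.1) =
    t *: (x - s.1) + (1 - t) *: (y - s'.1).
  by apply/rowP => i; rewrite !mxE; ring.
move: (x - s.1) (y - s'.1) => u w.
rewrite sqr_enormD !enormZ dotZl dotZr !exprMn !real_normK ?num_real//.
have : 0 <= enorm (u - w) ^+ 2 by rewrite sqr_ge0.
rewrite sqr_enormB; have : 0 <= t * (1 - t) by rewrite mulr_ge0 ?subr_ge0.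
move=> tt uw; have := mulr_ge0 tt uw; nra.
Qed.

(** The cost of a minimizer at [x] is a parabola that bounds [phi] from above
    and touches it at [x], so that [convex_quadratic_C1] applies. *)
Lemma envelope_C1 S phi : mixable S -> is_envelope S phi -> C1_in setT phi.
Proof.
move=> mS eS.
have /choice[q qP] : forall x, exists s, S s /\ phi x = cost s x.
  by move=> x; have [_ [s Ss xs]] := eS x; exists s.
apply: (@convex_quadratic_C1 _ _ phi (fun x => 2 *: (x - (q x).1)) 1) => //.
  exact: (envelope_convex mS eS).
move=> x h; have [Sq ->] := qP x.
by rewrite -cost_shift; exact: (eS _).1.
Qed.

Lemma dist_envelope C : compact C -> C !=set0 ->
  is_envelope [set s | C s.1 /\ s.2 = 0] (fun x => dist_from C x ^+ 2).
Proof.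
move=> cC C0 x; split=> [s [Cs s0]|].
  rewrite /cost s0 addr0 ler_sqr ?nnegrE ?enorm_ge0 ?dist_from_ge0//.
  exact: dist_from_le.
have [p Cp xp] := nearest_point x cC C0.
by exists (p, 0); rewrite // /cost/= addr0 xp.
Qed.

Lemma dist_mixable C : convex_set C -> mixable [set s | C s.1 /\ s.2 = 0].
Proof.
move=> /convex_setP cC s s' t [Cs s0] [Cs' s'0] t0 t1; exists 0.
  by split => //=; exact: cC.
by rewrite s0 s'0 !mulr0 addr0.
Qed.

(** The squared distance to a convex set is an envelope, hence C1, and it does
    not vanish outside the set. *)
Lemma dist_convex_differentiable C x : compact C -> convex_set C -> C !=set0 ->
  ~ C x -> differentiable (dist_from C) x.
Proof.
move=> cC vC C0 Cx.
have [p Cp xp] := nearest_point x cC C0.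
have d0 : 0 < dist_from C x ^+ 2.
  rewrite exprn_gt0// xp enorm_gt0 subr_eq0; apply/eqP => xE.
  by apply: Cx; rewrite xE.
have [dC _] := envelope_C1 (dist_mixable vC) (dist_envelope cC C0) (I : setT x).
have [+ _] := @differentiable_sqrt R 'rV[R]_n
  (fun y => dist_from C y ^+ 2) x d0 dC.
congr (differentiable _ x); apply/funext => y.
by rewrite sqrtr_sqr ger0_norm// dist_from_ge0.
Qed.

Lemma dist_boundary_outside C x : compact C -> C !=set0 -> ~ C x ->
  dist_from (boundary C) x = dist_from C x.
Proof.
move=> cC C0 Cx; have clC : closed C by exact: compact_closed.
have [p Cp xp] := nearest_point x cC C0.
have [t /andP[t0 t1] bt] := segment_meets_boundary clC Cp Cx.
apply/eqP; rewrite eq_le; apply/andP; split.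
  rewrite (le_trans (dist_from_le _ bt))// xp.
  have -> : x - (p + t *: (x - p)) = (1 - t) *: (x - p).
    by apply/rowP => i; rewrite !mxE; ring.
  by rewrite enormZ ger0_norm ?subr_ge0// ler_piMl ?enorm_ge0//; lra.
apply: le_dist_from; first by exists (p + t *: (x - p)).
by move=> a /(boundary_sub clC) Ca; exact: dist_from_le.
Qed.

(** Outside the convex set [C] the distance to its boundary agrees with the
    distance to [C], which is differentiable there. *)
Lemma singular_boundary_sub C : compact C -> convex_set C -> C !=set0 ->
  singular_set (boundary C) `<=` C.
Proof.
move=> cC vC C0 x [_ ndx]; apply: contrapT => Cx; apply: ndx.
apply: (@near_eq_differentiable R 'rV[R]_n _ (dist_from C)); last first.
  exact: dist_convex_differentiable.
have : open (~` C) by apply: closed_openC; exact: compact_closed.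
rewrite openE => /(_ _ Cx); apply: filterS => y Cy.
exact: dist_boundary_outside.
Qed.

(** The generators [(x0 + l (p - x0), e^2 l^2)] with [p] in [P] and [l >= 0]
    form a cone over [P] with apex [x0], so that the envelope is homogeneous of
    degree two around [x0]; it is a C1 substitute for [e^2] times the square of
    the gauge of [P]. *)
Definition cone_over P x0 e : set ('rV[R]_n * R) :=
  [set s | exists l p, [/\ 0 <= l, P p &
     s = (x0 + l *: (p - x0), e ^+ 2 * l ^+ 2)]].

Lemma cone_over_mixable P x0 e : convex_set P -> mixable (cone_over P x0 e).
Proof.
move=> /convex_setP cP _ _ t [l [p [l0 Pp ->]]] [l' [p' [l'0 Pp' ->]]] t0 t1 /=.
have t'0 : 0 <= 1 - t by rewrite subr_ge0.
pose m := t * l + (1 - t) * l'.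
have tl0 : 0 <= t * l by rewrite mulr_ge0.
have tl'0 : 0 <= (1 - t) * l' by rewrite mulr_ge0.
have m0 : 0 <= m by rewrite addr_ge0.
have [q Pq qE] : exists2 q, P q &
    m *: (q - x0) = (t * l) *: (p - x0) + ((1 - t) * l') *: (p' - x0).
  (* if the total weight vanishes, both points are the apex *)
  have [m1|m1] := eqVneq m 0.
    exists p => //; rewrite m1.
    have -> : t * l = 0 by move: m1; rewrite /m; lra.
    have -> : (1 - t) * l' = 0 by move: m1; rewrite /m; lra.
    by rewrite !scale0r addr0.
  exists ((t * l / m) *: p + (1 - t * l / m) *: p').
    apply: cP => //; first by rewrite divr_ge0.
    by rewrite ler_pdivrMr ?lt_neqAle ?m0 ?andbT 1?eq_sym// mul1r lerDl.
  by apply/rowP => i; rewrite !mxE; move: m1; rewrite /m => m1; field.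
exists (e ^+ 2 * m ^+ 2).
  exists m, q; split => //; congr (_, _); rewrite qE.
  by apply/rowP => i; rewrite !mxE; ring.
have -> : t * (e ^+ 2 * l ^+ 2) + (1 - t) * (e ^+ 2 * l' ^+ 2) =
    e ^+ 2 * (t * l ^+ 2 + (1 - t) * l' ^+ 2) by ring.
rewrite ler_wpM2l ?sqr_ge0//.
have := mulr_ge0 (mulr_ge0 t0 t'0) (sqr_ge0 (l - l')); rewrite /m; nra.
Qed.

Lemma cone_over_envelope P x0 e : compact P -> P !=set0 -> 0 < e ->
  exists phi, is_envelope (cone_over P x0 e) phi.
Proof.
move=> cP P0 e0.
suff /choice[q qP] : forall x, exists s, cone_over P x0 e s /\
    forall s', cone_over P x0 e s' -> cost s x <= cost s' x.
  exists (fun x => cost (q x) x) => x; have [Sq qmin] := qP x.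
  by split => //; exists (q x).
(* A parameter [l > L] costs more than [l = 0], so that minimizing over the
   compact set [[0, L] x P] is enough. *)
move=> x; pose L := enorm (x - x0) / e.
have L0 : 0 <= L by rewrite divr_ge0 ?enorm_ge0 ?ltW.
pose gen (u : R * 'rV[R]_n) := (x0 + u.1 *: (u.2 - x0), e ^+ 2 * u.1 ^+ 2).
pose A : set (R * 'rV[R]_n) := `[0, L]%classic `*` P.
have cA : compact A by apply: compact_setX => //; exact: segment_compact.
have A0 : A !=set0.
  by case: P0 => p Pp; exists (0, p); split; rewrite //= in_itv/= lexx.
have cf : {within A, continuous (fun u => cost (gen u) x)}.
  apply: continuous_subspaceT => u; rewrite /cost/=.
  apply: cvgD.
    apply: (@continuous_comp _ _ _ (fun u : R * 'rV[R]_n =>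
      x - (x0 + u.1 *: (u.2 - x0))) (fun v => enorm v ^+ 2)); last first.
      apply: (@continuous_comp _ _ _ (@enorm R n) (fun r => r ^+ 2)).
        exact: enorm_continuous.
      exact: exprn_continuous.
    apply: cvgB; first exact: cvg_cst.
    apply: cvgD; first exact: cvg_cst.
    apply: cvgZ; first exact: cvg_fst.
    by apply: cvgB; [exact: cvg_snd|exact: cvg_cst].
  apply: cvgMr.
  apply: (@continuous_comp _ _ _ fst (fun r : R => r ^+ 2)).
    exact: cvg_fst.
  exact: exprn_continuous.
have [u /set_mem[u1 u2] umin] := compact_EVT_min A0 cA cf.
move: u1; rewrite /= in_itv/= => /andP[u10 u1L].
exists (gen u); split; first by exists u.1, u.2.
move=> _ [l [p [l0 Pp ->]]].
have [lL|Ll] := leP l L.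
  have Alp : A (l, p) by split; rewrite //= in_itv/= l0.
  exact: (umin _ (mem_set Alp)).
have A0p : A (0, p) by split; rewrite //= in_itv/= lexx.
apply: (le_trans (umin _ (mem_set A0p))).
rewrite /cost/= scale0r addr0 expr0n/= mulr0 addr0.
have -> : enorm (x - x0) = e * L by rewrite /L mulrC divfK// gt_eqF.
rewrite exprMn; have : L ^+ 2 <= l ^+ 2 by rewrite ler_sqr ?nnegrE// ltW.
rewrite -(ler_pM2l (exprn_gt0 2 e0)).
have := sqr_ge0 (enorm (x - (x0 + l *: (p - x0)))); lra.
Qed.

(** The last two properties place the sublevel set of [phi] at [e^2] between
    [P] and its [e]-neighbourhood: points of [P] have cost at most [e^2] with
    [l = 1], and conversely cost at most [e^2] forces [l <= 1]. *)
Lemma cone_over_smoothing P x0 e :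
  compact P -> convex_set P -> P x0 -> 0 < e ->
  exists phi : 'rV[R]_n -> R,
    [/\ C1_in setT phi, convex_fun phi,
      forall k v, 0 < k -> phi (x0 + k *: v) = k ^+ 2 * phi (x0 + v),
      forall x, x != x0 -> 0 < phi x &
      (forall x, P x -> phi x <= e ^+ 2) /\
      (forall x, phi x <= e ^+ 2 -> dist_from P x <= e)].
Proof.
move=> cP vP Px0 e0; have P0 : P !=set0 by exists x0.
have [phi ephi] := cone_over_envelope x0 cP P0 e0.
have mP := @cone_over_mixable P x0 e vP.
exists phi; split; [exact: (envelope_C1 mP)|exact: (envelope_convex mP)| | |].
- have half k v : 0 < k -> phi (x0 + k *: v) <= k ^+ 2 * phi (x0 + v).
    move=> k0; have [_ [_ [l [p [l0 Pp ->]]] ->]] := ephi (x0 + v).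
    have Sk : cone_over P x0 e
        (x0 + (k * l) *: (p - x0), e ^+ 2 * (k * l) ^+ 2).
      by exists (k * l), p; split => //; rewrite mulr_ge0// ltW.
    rewrite (le_trans ((ephi _).1 _ Sk))// /cost/=.
    have -> : x0 + k *: v - (x0 + (k * l) *: (p - x0)) =
        k *: (x0 + v - (x0 + l *: (p - x0))).
      by apply/rowP => i; rewrite !mxE; ring.
    by rewrite enormZ gtr0_norm// !exprMn mulrDr; lra.
  move=> k v k0; apply/eqP; rewrite eq_le half//=.
  have := half k^-1 (k *: v); rewrite invr_gt0 => /(_ k0).
  rewrite scalerA mulVf ?gt_eqF// scale1r exprVn.
  by rewrite ler_pdivlMl ?exprn_gt0.
- move=> x xx0; have [_ [_ [l [p [l0 Pp ->]]] ->]] := ephi x.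
  rewrite /cost/=; have [->|l1] := eqVneq l 0.
    rewrite scale0r addr0 expr0n/= mulr0 addr0 exprn_gt0// enorm_gt0.
    by rewrite subr_eq0.
  by rewrite ltr_wpDl ?sqr_ge0// mulr_gt0// exprn_gt0// lt_neqAle eq_sym l1.
- split=> [x Px|x].
    have S1 : cone_over P x0 e (x0 + 1 *: (x - x0), e ^+ 2 * 1 ^+ 2).
      by exists 1, x.
    rewrite (le_trans ((ephi _).1 _ S1))// /cost/= scale1r [x0 + _]addrC subrK.
    by rewrite subrr enorm0 expr0n/= add0r expr1n mulr1.
  have [_ [_ [l [p [l0 Pp ->]]] ->]] := ephi x; rewrite /cost/= => xe.
  have l1 : l <= 1.
    rewrite -(@ler_pXn2r _ 2) ?nnegrE// expr1n.
    rewrite -(ler_pM2l (exprn_gt0 2 e0)) mulr1 (le_trans _ xe)//.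
    by rewrite lerDr sqr_ge0.
  have Pl : P (x0 + l *: (p - x0)).
    have -> : x0 + l *: (p - x0) = l *: p + (1 - l) *: x0.
      by apply/rowP => i; rewrite !mxE; ring.
    by move/convex_setP : vP; exact.
  rewrite (le_trans (dist_from_le _ Pl))//.
  rewrite -ler_sqr ?nnegrE ?enorm_ge0 ?(ltW e0)//.
  by rewrite (le_trans _ xe)// lerDl mulr_ge0// sqr_ge0.
Qed.

End envelope.

(** * Unit spheres of C1 gauges are C1 hypersurfaces *)

Section C1_charts.
Context {R : realType} {n : nat}.
Implicit Types (U : set 'rV[R]_n).

Lemma cvg_mx_coord (T : Type) (F : set_system T) (FF : Filter F) p q
    (f : T -> 'M[R]_(p, q)) (M : 'M[R]_(p, q)) :
  (forall i j, (fun t => f t i j) @ F --> M i j) -> f @ F --> M.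
Proof.
move=> fM; apply/cvgrPdist_le => e e0; near=> t.
rewrite /Num.Def.normr/= mx_normrE (bigmax_le _ (ltW e0))//= => i _.
rewrite !mxE/=; move: i; near: t; apply: filter_forall => /= i.
exact: ((cvgrPdist_le _ _).1 (fM i.1 i.2)).
Unshelve. all: by end_near. Qed.

Lemma C1_on_coord m U (f : 'rV[R]_n -> 'rV[R]_m) : open U ->
  (forall i, C1_in U (fun x => f x ord0 i)) -> C1_on U f.
Proof.
move=> oU Cf.
have fE : f = \sum_(i < m) (fun x => f x ord0 i *: delta_mx ord0 i).
  apply/funext => x; rewrite fct_sumE [LHS]row_sum_delta.
  by apply: eq_bigr.
have df x : U x -> differentiable f x.
  move=> Ux; rewrite fE; apply: differentiable_sum => i.
  by apply: differentiableZl; have [] := Cf i _ Ux.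
have dfE x v j : U x -> ('D_v f x) ord0 j = 'D_v (fun y => f y ord0 j) x.
  move=> Ux; have cd := @dot_continuous _ _ (delta_mx ord0 j : 'rV[R]_m).
  have -> : (fun y => f y ord0 j) = (fun y => dot (delta_mx ord0 j) (f y)).
    by apply/funext => y; rewrite /= dotC dot_delta.
  by rewrite (derive_linear_comp v cd (df _ Ux))/= dotC dot_delta.
move=> x Ux; split; first exact: df.
apply: (@cvg_mx_coord _ _ (nbhs_filter x)) => k j.
have jE y : U y ->
    jacobian f y k j = 'D_(delta_mx ord0 k) (fun z => f z ord0 j) y.
  by move=> Uy; rewrite -dfE// (deriveEjacobian _ (df _ Uy)) -rowE [RHS]mxE.
have [_ /(_ (delta_mx ord0 k)) cf] := Cf j _ Ux.
exact: (@continuous_eq_on R 'rV[R]_n R U (fun y => jacobian f y k j) _ x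
  oU Ux jE cf).
Qed.

(** A projection onto the kernel of [dot l] only when [dot l a = 1]. *)
Definition oblique_proj (l a : 'rV[R]_n) (y : 'rV[R]_n) := y - dot l y *: a.

Let oblique_proj_linear l a : linear (oblique_proj l a).
Proof.
move=> k x y; rewrite /oblique_proj dotDr dotZr.
by apply/rowP => i; rewrite !mxE; ring.
Qed.

HB.instance Definition _ l a := GRing.isLinear.Build R 'rV[R]_n 'rV[R]_n _
  (oblique_proj l a) (oblique_proj_linear l a).

Lemma oblique_proj_continuous l a : continuous (oblique_proj l a).
Proof.
move=> y; apply: (@cvgB _ _ _ _ (nbhs_filter y)); first exact: cvg_id.
apply: (@cvgZr_tmp _ _ _ _ (nbhs_filter y)).
exact: dot_continuous.
Qed.

Lemma open_rV_neq (x0 : 'rV[R]_n) : open [set x | x != x0].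
Proof.
rewrite openE => x xx0; apply/nbhs_enormP; exists (enorm (x - x0)).
  by rewrite enorm_gt0 subr_eq0.
by move=> y; apply: contraTneq => ->; rewrite enormB ltxx.
Qed.

Lemma C1_in_dot U (l : 'rV[R]_n) : open U -> C1_in U (dot l).
Proof.
move=> oU; have cl : continuous (dot l) := @dot_continuous _ _ l.
exact: (C1_in_linear oU cl).
Qed.

Section gauge_chart.
Variables (x0 a l : 'rV[R]_n) (G : 'rV[R]_n -> R).
Hypothesis la1 : dot l a = 1.
Hypothesis G_C1 : C1_in [set x | x != x0] G.
Hypothesis G_homo : forall k v, 0 < k -> G (x0 + k *: v) = k * G (x0 + v).

Let U : set 'rV[R]_n := [set x | 0 < dot l (x - x0)].

(** Let [L = dot l (x - x0)], and let [w = (x - x0) / L] be the central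
    projection of [x] onto the hyperplane [dot l = 1]. By homogeneity
    [G x / L = G (x0 + w)], so that
    [chart x = (w - a) + (1 / L - G (x0 + w)) a]. In the coordinates [w] and
    [1 / L] the sphere [G = 1] is the graph of [G (x0 + w)], which the chart
    flattens. *)
Definition chart x := (dot l (x - x0))^-1 *: (x - x0 + (1 - G x) *: a) - a.

(** At [y = chart x] this is [1 / dot l (x - x0)]. *)
Definition chart_den y := dot l y + G (x0 + a + oblique_proj l a y).

Definition chart_inv y := x0 + (chart_den y)^-1 *: (a + oblique_proj l a y).

Let dot_oblique y : dot l (a + oblique_proj l a y) = 1.
Proof. by rewrite /oblique_proj !(dotDr, dotNr) dotZr la1; ring. Qed.

Let dot_chart x : U x -> dot l (chart x) = (1 - G x) / dot l (x - x0).
Proof.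
rewrite /U/= => Ux; rewrite /chart !(dotBr, dotDr, dotZr) la1.
by rewrite dotBr in Ux; field; rewrite gt_eqF.
Qed.

Let chart_point x : U x ->
  a + oblique_proj l a (chart x) = (dot l (x - x0))^-1 *: (x - x0).
Proof.
move=> Ux; rewrite /oblique_proj dot_chart// /chart.
by apply/rowP => i; rewrite !mxE; ring.
Qed.

Let chart_den_chart x : U x -> chart_den (chart x) = (dot l (x - x0))^-1.
Proof.
move=> Ux; have Lx : 0 < dot l (x - x0) by [].
rewrite /chart_den -addrA chart_point// dot_chart//.
rewrite G_homo ?invr_gt0// [x0 + _]addrC subrK.
by move: (dot l _) Lx => L L0; field; rewrite gt_eqF.
Qed.

Let chartK x : U x -> chart_inv (chart x) = x.
Proof.
move=> Ux; rewrite /chart_inv chart_den_chart// chart_point// invrK.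
by rewrite scalerA divff ?gt_eqF// scale1r addrC subrK.
Qed.

Let chart_invK y : 0 < chart_den y ->
  U (chart_inv y) /\ chart (chart_inv y) = y.
Proof.
move=> dy; have xE : chart_inv y - x0 =
    (chart_den y)^-1 *: (a + oblique_proj l a y).
  by rewrite /chart_inv addrC addKr.
have lx : dot l (chart_inv y - x0) = (chart_den y)^-1.
  by rewrite xE dotZr dot_oblique mulr1.
split; first by rewrite /U/= lx invr_gt0.
have Gx : G (chart_inv y) = (chart_den y)^-1 * (chart_den y - dot l y).
  rewrite /chart_inv G_homo ?invr_gt0// addrA.
  by rewrite /chart_den [dot l y + _]addrC addrK.
rewrite /chart lx invrK xE Gx /oblique_proj.
move: (chart_den y) (dot l y) dy => D r D0.
by apply/rowP => i; rewrite !mxE; field; rewrite gt_eqF.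
Qed.

Lemma gauge_domain_open : open U.
Proof.
have cU : continuous (fun x : 'rV[R]_n => dot l (x - x0)).
  apply: (@enorm_lipschitz_continuous _ _ _ (enorm l)) => y z.
  have -> : dot l (y - x0) - dot l (z - x0) = dot l (y - z).
    by rewrite !dotBr; ring.
  exact: dot_le.
rewrite (_ : U = (fun x => dot l (x - x0)) @^-1` [set r | 0 < r])//.
by apply: open_comp; [move=> x _; exact: cU|exact: open_gt].
Qed.

Let chart_den_C1 : C1_in setT chart_den.
Proof.
apply: C1_in_add; [exact: openT|apply: C1_in_dot; exact: openT|].
apply: C1_in_sub (C1_in_affine _ _ G_C1) => [y _|/=|]; last 2 first.
- exact: open_rV_neq.
- exact: oblique_proj_continuous.
rewrite /= -addrA; apply/eqP => /(congr1 (fun z => dot l (z - x0))).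
rewrite [x0 + _]addrC addrK dot_oblique subrr dotC.
by rewrite -(scale0r 0) dotZl mul0r => /eqP; rewrite oner_eq0.
Qed.

Let chart_image : chart @` U = [set y | 0 < chart_den y].
Proof.
apply/seteqP; split=> [_ [x Ux <-]/=|y /chart_invK[Uy yE]].
  by rewrite chart_den_chart// invr_gt0.
by exists (chart_inv y).
Qed.

Let chart_image_open : open (chart @` U).
Proof.
rewrite chart_image.
rewrite (_ : [set y | _] = chart_den @^-1` [set r | 0 < r])//.
apply: open_comp; last exact: open_gt.
by move=> x _; exact: (C1_in_continuous chart_den_C1).
Qed.

Let chart_C1 : C1_on U chart.
Proof.
have oU := gauge_domain_open; apply: (C1_on_coord oU) => i.
have -> : (fun x => chart x ord0 i) = (fun x =>
    (dot l x + - dot l x0)^-1 * (dot (delta_mx ord0 i) x + - x0 ord0 i +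
      (1 + -1 * G x) * a ord0 i) + - a ord0 i).
  apply/funext => x; rewrite (dotC (delta_mx _ _)) dot_delta /chart !mxE dotBr.
  by congr (_ * _ + _); ring.
have GU : C1_in U G.
  apply: C1_in_sub G_C1 => x; rewrite /U/=; apply: contraTneq => ->.
  by rewrite dotBr subrr ltxx.
apply: (C1_in_add oU); last exact: (C1_in_cst _ oU).
apply: (C1_in_mul oU).
  apply: (C1_in_inv oU).
    apply: (C1_in_add oU); first exact: (C1_in_dot _ oU).
    exact: (C1_in_cst _ oU).
  by move=> x; rewrite /U/= dotBr => Ux; rewrite gt_eqF.
apply: (C1_in_add oU).
  apply: (C1_in_add oU); first exact: (C1_in_dot _ oU).
  exact: (C1_in_cst _ oU).
apply: (C1_in_mul oU); last exact: (C1_in_cst _ oU).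
apply: (C1_in_add oU); first exact: (C1_in_cst _ oU).
by apply: (C1_in_mul oU); [exact: (C1_in_cst _ oU)|].
Qed.

Let chart_inv_C1 : C1_on (chart @` U) chart_inv.
Proof.
have oV := chart_image_open.
apply: (C1_on_coord oV) => i.
have -> : (fun y => chart_inv y ord0 i) = (fun y => x0 ord0 i +
    (chart_den y)^-1 *
    (a ord0 i + (dot (delta_mx ord0 i) y + - a ord0 i * dot l y))).
  apply/funext => y; rewrite (dotC (delta_mx _ _)) dot_delta.
  rewrite /chart_inv /oblique_proj !mxE.
  by congr (_ + _ * _); ring.
apply: (C1_in_add oV); first exact: (C1_in_cst _ oV).
apply: (C1_in_mul oV).
  apply: (C1_in_inv oV); first exact: C1_in_sub chart_den_C1.
  by move=> y; rewrite chart_image/= => ?; rewrite gt_eqF.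
apply: (C1_in_add oV); first exact: (C1_in_cst _ oV).
apply: (C1_in_add oV); first exact: (C1_in_dot _ oV).
apply: (C1_in_mul oV); [exact: (C1_in_cst _ oV)|exact: (C1_in_dot _ oV)].
Qed.

Lemma gauge_chart_diffeo : C1_diffeo_on U chart.
Proof.
split; [exact: chart_image_open|exact: chart_C1|].
by exists chart_inv; [exact: chartK|exact: chart_inv_C1].
Qed.

Lemma gauge_chart_straightens :
  chart @` (U `&` [set x | G x = 1]) = [set y | dot l y = 0] `&` chart @` U.
Proof.
apply/seteqP; split=> [_ [x [Ux /= Gx] <-]|y [/= ly [x Ux yE]]].
  by split; [rewrite /= dot_chart// Gx subrr mul0r|exists x].
move: ly; rewrite -yE dot_chart// => /eqP.
by rewrite mulf_eq0 invr_eq0 (gt_eqF Ux) orbF subr_eq0 => /eqP G1; exists x.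
Qed.

End gauge_chart.

Lemma dot_kernel (l : 'rV[R]_n) : l != 0 ->
  exists2 Z : {vspace 'rV[R]_n}, [set` Z] = [set y | dot l y = 0] &
    (\dim Z = n.-1)%N.
Proof.
move=> l0; pose L : {linear 'rV[R]_n -> R^o} := dot l.
exists (lker (linfun L)).
  apply/seteqP; split=> y /=; first by rewrite memv_ker lfunE => /eqP.
  by move=> ly; rewrite memv_ker lfunE/= ly.
have := limg_ker_dim (linfun L) fullv; rewrite capfv dimvf /dim/= mul1n.
have -> : \dim (limg (linfun L)) = 1%N.
  apply/eqP; rewrite eqn_leq; apply/andP; split.
    by have := dimvS (subvf (limg (linfun L))); rewrite dimvf.
  rewrite lt0n dimv_eq0; apply/eqP => L0.
  have := memv_img (linfun L) (memvf l).
  rewrite L0 memv0 lfunE/= dotxx expf_eq0/= => /eqP/enorm_eq0.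
  by move/eqP: l0.
by move=> /(congr1 predn); rewrite addn1.
Qed.

(** Near a point [b] of the sphere, the chart is the one given by [a = b - x0]
    and by the functional [dot l] with [l] proportional to [a]. *)
Lemma gauge_hypersurface (x0 : 'rV[R]_n) (G : 'rV[R]_n -> R) :
  C1_in [set x | x != x0] G ->
  (forall k v, 0 < k -> G (x0 + k *: v) = k * G (x0 + v)) ->
  C1_hypersurface [set x | G x = 1].
Proof.
move=> GC1 Gh b /= Gb.
have G0 : G x0 = 0.
  by have := Gh 2 0 (ltr0n _ 2); rewrite scaler0 addr0; lra.
have a0 : b - x0 != 0.
  rewrite subr_eq0; apply/eqP => bE; move: Gb; rewrite bE G0 => /esym/eqP.
  by rewrite oner_eq0.
set a := b - x0 in a0.
have ea : 0 < enorm a ^+ 2 by rewrite exprn_gt0// enorm_gt0.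
pose l := (enorm a ^+ 2)^-1 *: a.
have la : dot l a = 1 by rewrite dotZl dotxx mulVf// gt_eqF.
have l0 : l != 0 by rewrite scaler_eq0 negb_or invr_eq0 gt_eqF.
have [Z ZE dimZ] := dot_kernel l0.
exists [set x | 0 < dot l (x - x0)], Z, (chart x0 a l G).
split; last 1 first.
- by rewrite ZE; exact: gauge_chart_straightens.
- split; first exact: gauge_domain_open.
  by rewrite /= la.
- exact: dimZ.
- exact: gauge_chart_diffeo.
Qed.

End C1_charts.

(** * Genericity *)

Section generic_bodies.
Context {R : realType} {n : nat}.
Implicit Types (x y z : 'rV[R]_n) (P : set 'rV[R]_n) (e r : R).

(** Homogeneity with a positive degree excludes interior points at the level
    [r]: moving away from [x0] increases [phi]. *)
Lemma boundary_gauge_sublevel (phi : 'rV[R]_n -> R) x0 r : 0 < r ->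
  continuous phi ->
  (forall k v, 0 < k -> phi (x0 + k *: v) = k ^+ 2 * phi (x0 + v)) ->
  boundary [set x | phi x <= r] = [set x | phi x = r].
Proof.
move=> r0 cphi hphi; have cB := @closed_sublevel _ _ phi r cphi.
apply/seteqP; split=> [x bx|x /= xr].
  have xr : phi x <= r := boundary_sub cB bx.
  apply/eqP; rewrite eq_le xr leNgt; apply/negP => xr'.
  case: bx => _; apply; have : open (phi @^-1` [set s | s < r]).
    by apply: open_comp; [move=> y _; exact: cphi|exact: open_lt].
  by rewrite openE => /(_ _ xr'); apply: filterS => y /ltW.
split; first by apply: subset_closure; rewrite /= xr.
move=> /nbhs_enormP[d d0 dB].
pose v := x - x0; pose h := d / (enorm v + 1).
have h0 : 0 < h by rewrite divr_gt0// ltr_wpDl// enorm_ge0.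
have h1 : 0 < 1 + h by lra.
have hd : h * enorm v < d.
  rewrite /h mulrAC ltr_pdivrMr ?ltr_wpDl ?enorm_ge0//.
  by rewrite ltr_pM2l// ltrDl.
have := dB (x0 + (1 + h) *: v); rewrite /= hphi//.
rewrite [x0 + v]addrC subrK xr.
have -> : x0 + (1 + h) *: v - x = h *: v.
  by apply/rowP => i; rewrite !mxE; ring.
rewrite enormZ gtr0_norm// => /(_ hd).
have := mulr_gt0 h0 r0; have := mulr_gt0 h0 h0; nra.
Qed.

(** The approximating body is the sublevel set at [e^2] of the smoothing of
    the cone over [P]; its gauge around [x0] is the square root of [phi]
    divided by [e]. *)
Lemma regular_bodies_dense P x0 e :
  compact P -> convex_set P -> P x0 -> 0 < e ->
  exists B : regular_body R n, hausdorff_dist P B <= e.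
Proof.
move=> cP vP Px0 e0; have P0 : P !=set0 by exists x0.
have e20 : 0 < e ^+ 2 by rewrite exprn_gt0.
have [phi [Cphi vphi hphi phi0 [Pphi phiP]]] :=
  cone_over_smoothing cP vP Px0 e0.
have cphi : continuous phi by move=> x; exact: (C1_in_continuous Cphi).
have phix0 : phi x0 = 0.
  by have := hphi 2 0 (ltr0n _ 2); rewrite scaler0 addr0; lra.
have phi_ge0 x : 0 <= phi x.
  by have [->|/phi0/ltW//] := eqVneq x x0; rewrite phix0.
pose B := [set x | phi x <= e ^+ 2].
have clB : closed B by exact: closed_sublevel.
have cB : compact B.
  have [D _ PD] := compact_enorm_bounded cP.
  apply: (@enorm_bounded_compact _ _ _ (e + D)) => // x /phiP xe.
  have [p Pp xp] := nearest_point x cP P0.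
  rewrite -(subrK p x) (le_trans (enormD _ _))// lerD// ?PD//.
  by rewrite -xp.
have vB : convex_set B.
  apply/convex_setP => x y t Bx By t0 t1; rewrite /B/= in Bx By *.
  rewrite (le_trans (vphi _ _ _ t0 t1))//.
  have := ler_wpM2l t0 Bx; have t'0 : 0 <= 1 - t by rewrite subr_ge0.
  have := ler_wpM2l t'0 By; lra.
have iB : B° !=set0.
  exists x0; have : open (phi @^-1` [set s | s < e ^+ 2]).
    by apply: open_comp; [move=> y _; exact: cphi|exact: open_lt].
  rewrite openE => /(_ x0); rewrite /= phix0 => /(_ e20).
  by apply: filterS => y /ltW.
have bB : C1_hypersurface (boundary B).
  rewrite (boundary_gauge_sublevel e20 cphi hphi).
  have -> : [set x | phi x = e ^+ 2] =
      [set x | Num.sqrt (phi x) * e^-1 = 1].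
    apply/seteqP; split=> x /= => [->|].
      by rewrite sqrtr_sqr gtr0_norm// divff// gt_eqF.
    move=> /(canRL (divfK _)) /=; rewrite gt_eqF// mul1r => /(_ isT) <-.
    by rewrite sqr_sqrtr.
  have oU := @open_rV_neq _ _ x0.
  apply: (@gauge_hypersurface _ _ x0 (fun x => Num.sqrt (phi x) * e^-1)).
    apply: (C1_in_mul oU); last exact: (C1_in_cst _ oU).
    apply: (C1_in_sqrt oU) => //.
    exact: (C1_in_sub (@subsetT _ _) Cphi).
  move=> k v k0; rewrite hphi// sqrtrM ?sqr_ge0// sqrtr_sqr gtr0_norm//.
  by rewrite mulrA.
exists (RegularBody cB vB iB bB) => /=.
apply: hausdorff_dist_le => //.
- by exists x0; exact: Pphi.
- by move=> p Pp; rewrite dist_from_mem ?ltW//; exact: Pphi.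
Qed.

Lemma ex_rat_approx x e : 0 < e ->
  exists q : 'rV[rat]_n, enorm (map_mx ratr q - x) < e.
Proof.
move=> e0; pose d := e / (n%:R + 1).
have n1 : 0 < n%:R + 1 :> R by rewrite ltr_wpDl.
have d0 : 0 < d by rewrite divr_gt0.
have /choice[q qP] : forall i, exists q : rat, `|ratr q - x ord0 i| <= d.
  move=> i; have [|q] := @rat_in_itvoo R (x ord0 i - d) (x ord0 i + d).
    by lra.
  rewrite in_itv/= => /andP[q1 q2]; exists q.
  by rewrite ler_norml; lra.
exists (\row_i q i); rewrite (le_lt_trans (enorm_le_norm _))//.
apply: (@le_lt_trans _ _ (n%:R * d)).
  rewrite ler_wpM2l// /Num.norm/= mx_normrE (bigmax_le _ (ltW d0))//= => i _.
  by rewrite !mxE (ord1 i.1).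
by rewrite /d mulrC mulrAC ltr_pdivrMr// ltr_pM2l//; lra.
Qed.

Definition singularity_free z r : set (regular_body R n) :=
  [set C | body_set C z /\
     forall y, singular_set (boundary (body_set C)) y -> r <= enorm (y - z)].

(** Near any body [C1] of the family there is a convex body [P] with two
    nearest boundary points at some [x] close to [z], and near [P] there is a
    body [B] with C1 boundary; by stability no body close to [B] is in the
    family. *)
Lemma singularity_free_nowhere_dense z r : (2 <= n)%N -> 0 < r ->
  nowhere_dense (singularity_free z r).
Proof.
move=> n2 r0; rewrite /nowhere_dense -subset0 => C0 /nbhs_ballP[e /= e0 eC].
have [|C1 [[C1z _] C01]] := eC C0 (ballxx _ e0) (ball C0 e).
  exact: nbhsx_ballx.
move: C01; rewrite ballEmdist/= => C01.
pose d := e - mdist C0 C1; have d0 : 0 < d by rewrite subr_gt0.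
have cC1 := @body_compact _ _ C1; have vC1 := @body_convex _ _ C1.
have clz : closure (body_set C1)° z.
  exact: (convex_closure_interior vC1 (body_interior C1)).
have [|x [C1x xz]] := clz [set x | enorm (x - z) < r / 2].
  by apply/nbhs_enormP; exists (r / 2) => //; rewrite divr_gt0.
have d30 : 0 < d / 3 by rewrite divr_gt0.
have [P [cP vP PC1 [s [a [b [s0 sP [bPa bPb] [sa sb] ab]]]]]] :=
  two_nearest_points_cut n2 cC1 vC1 C1x d30.
have Px : P x by apply: sP; apply: cball_center; exact: ltW.
pose rho := Num.min (r / 2) (s / 2).
have rho0 : 0 < rho by rewrite lt_min !divr_gt0.
have rhos : rho < s by rewrite gt_min; apply/orP; right; lra.
have rhor : rho <= r / 2 by rewrite ge_min lexx.
have [h h0 hP] := two_nearest_points_stable cP vP rho0 rhos sP bPa bPb sa sb ab.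
pose g := Num.min (h / 3) (d / 3).
have g0 : 0 < g by rewrite lt_min !divr_gt0.
have gh : g <= h / 3 by rewrite ge_min lexx.
have gd : g <= d / 3 by rewrite ge_min lexx orbT.
have [B PB] := regular_bodies_dense cP vP Px g0.
have P0 : P !=set0 by exists x.
have C0B : ball C0 e B.
  rewrite ballEmdist/= (le_lt_trans (metric_triangle _ C1 _))//.
  have : mdist C1 B <= hausdorff_dist C1 P + hausdorff_dist P B.
    rewrite regular_body_mdistE; apply: hausdorff_dist_triangle => //;
      by [exact: body_nonempty|exact: body_compact].
  by rewrite hausdorff_distC /d in PC1 gd d0 *; lra.
have [|C2 [[C2z noS] C2B]] := eC B C0B (ball B (h / 2)).
  by apply: nbhsx_ballx; rewrite divr_gt0.
move: C2B; rewrite ballEmdist/= regular_body_mdistE => C2B.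
have [||||y yx Sy] := hP (body_set C2).
- exact: body_compact.
- exact: body_convex.
- exact: body_nonempty.
- have : hausdorff_dist P C2 <= hausdorff_dist P B + hausdorff_dist B C2.
    by apply: hausdorff_dist_triangle => //;
      by [exact: body_nonempty|exact: body_compact].
  lra.
have := noS _ Sy; have := enorm_triangle x y z.
move: yx xz; rewrite /cball/=; lra.
Qed.

End generic_bodies.

Theorem theorem3p1 (R : realType) (n : nat) (hn : (2 <= n)%N) :
  exists2 M : set (regular_body R n), meager M &
    forall C : regular_body R n, ~ M C ->
      body_set C = closure (singular_set (boundary (body_set C))).
Proof.
pose rad (k : nat) : R := k.+1%:R^-1.
pose F i : set (regular_body R n) :=
  if unpickle i is Some (q, k)
  then singularity_free (map_mx ratr (q : 'rV[rat]_n)) (rad k)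
  else set0.
exists (\bigcup_i F i).
  exists F => // i; rewrite /F; case: (unpickle i) => [[q k]|].
    by apply: singularity_free_nowhere_dense; rewrite // invr_gt0.
  by rewrite /nowhere_dense closure0 interior0.
move=> C noMC.
have cC := @body_compact _ _ C; have vC := @body_convex _ _ C.
have C0 := body_nonempty C.
apply/seteqP; split; last first.
  rewrite [X in _ `<=` X](closure_id _).1; last exact: compact_closed.
  by apply: closureS; exact: singular_boundary_sub.
move=> x Cx U /nbhs_enormP[e e0 eU].
have clx : closure (body_set C)° x.
  exact: (convex_closure_interior vC (body_interior C)).
have [|y [/nbhs_enormP[d d0 dC] yx]] := clx [set y | enorm (y - x) < e / 2].
  by apply/nbhs_enormP; exists (e / 2) => //; rewrite divr_gt0.
(* [m <= d] keeps the rational point in [C], and [m <= e / 4] makes a singular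
   point at distance less than [m] from it [e]-close to [x] *)
pose m := Num.min d (e / 4).
have m0 : 0 < m by rewrite lt_min d0 divr_gt0.
have md : m <= d by rewrite ge_min lexx.
have me : m <= e / 4 by rewrite ge_min lexx orbT.
have [q qy] := ex_rat_approx y m0; set z := map_mx _ _ in qy.
have [k km] : exists k, rad k < m.
  exists (Num.truncn m^-1); rewrite /rad invf_plt ?posrE//.
  exact: truncnS_gt.
apply: contrapT => noS; apply: noMC.
exists (pickle (q, k)) => //; rewrite /F pickleK; split.
  by apply: dC; exact: lt_le_trans md.
move=> w Sw; rewrite leNgt; apply/negP => wz; apply: noS; exists w; split => //.
apply: eU.
have := enorm_triangle z w x; have := enorm_triangle y z x.
move: yx; rewrite -/z in wz *; rewrite /=; lra.
Qed.
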